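(* Let $b$ be a prime power, $s\ge2$, $d\ge1$, $t\ge0$ integers, $d_0=d+t$, $m_k=s^2d_0(2^{2k+2}-1)$ for $k=1,2,\dots$, and $K_{d,t,s+1}=4(d+t)s^2$. Let $(\mathbf x_n)_{n\ge0}$ be a digital $d$-admissible $(t,s)$-sequence in base $b$. Then there exist a matrix $C^{(s+1)}=(c^{(s+1)}_{i,j})_{i,j\ge1}$ over $\mathbb F_b$ and a sequence $(h^{-1}(n))_{n\ge0}$ of nonnegative integers such that: - the upper-left $m_k\times m_k$ submatrix $[C^{(s+1)}]_{m_k}$ is nonsingular for every $k\ge1$; - with $h_k$ the bijection of $\{0,\dots,b^{m_k}-1\}$ determined by $[C^{(s+1)}]_{m_k}$ (see context), $h^{-1}(n)=h_l^{-1}(n)=h_k^{-1}(n)$ for all $n\in[0,b^{m_k})$, $l>k\ge1$; - $(\mathbf x_{h^{-1}(n)})_{n\ge0}$ is a $d$-admissible $(t,s)$-sequence in base $b$; - for all $k\ge1$, $$1+\min_{0\le Q<b^{m_k},\ \mathbf w\in E_{m_k}^s}\ \max_{1\le N\le b^{m_k}}ND^*\big((\mathbf x_{h^{-1}(n)\oplus Q}\oplus\mathbf w)_{0\le n<N}\big)\ \ge\ 2^{-2}b^{-d}K_{d,t,s+1}^{-s}\,m_k^s .$$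
   Context: **The maps $h_k$.** Let $Z_b=\{0,\dots,b-1\}$ and fix a bijection $\phi:Z_b\to\mathbb F_b$ with $\phi(0)=0$. For $n\in[0,b^{m_k})$, $n=\sum_{r=0}^{m_k-1}a_r(n)b^r$ with $a_r(n)\in Z_b$, identify $n$ with the row vector $\mathbf n=(\phi(a_0(n)),\dots,\phi(a_{m_k-1}(n)))\in\mathbb F_b^{m_k}$. Put $(h_{k,1}(n),\dots,h_{k,m_k}(n))=\mathbf n\,[C^{(s+1)}]_{m_k}^{\top}$ and $h_k(n)=\sum_{j=1}^{m_k}\phi^{-1}(h_{k,j}(n))b^{j-1}$. When $[C^{(s+1)}]_{m_k}$ is nonsingular, $h_k$ is a bijection of $\{0,\dots,b^{m_k}-1\}$, and $h_k^{-1}$ is its inverse. **Digital sequence.** Given $\infty\times\infty$ matrices $C^{(i)}=(c^{(i)}_{j,r})_{j\ge1,r\ge0}$ $(1\le i\le s)$ over $\mathbb F_b$, for $n=\sum_{r\ge0}a_r(n)b^r$ put $y^{(i)}_{n,j}=\sum_{r\ge0}c^{(i)}_{j,r}\phi(a_r(n))$, $x^{(i)}_n=\sum_{j\ge1}\phi^{-1}(y^{(i)}_{n,j})b^{-j}$ (the digits of $x^{(i)}_n$ are understood to be these) and $\mathbf x_n=(x_n^{(1)},\dots,x_n^{(s)})$. Such a sequence is called digital. **$(t,s)$-sequences.** An elementary interval in base $b$ is $\prod_{i=1}^s[a_ib^{-d_i},(a_i+1)b^{-d_i})$ with integers $d_i\ge0$, $0\le a_i<b^{d_i}$. A $(t,m,s)$-net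 in base $b$ ($0\le t\le m$) consists of $b^m$ points such that every elementary interval of volume $b^{t-m}$ contains exactly $b^t$ of them. $(\mathbf x_n)_{n\ge0}$ is a $(t,s)$-sequence in base $b$ if for all $k\ge0$, $m\ge t$ the points $\mathbf x_n$, $kb^m\le n<(k+1)b^m$, form a $(t,m,s)$-net. **Digitwise operations.** For $x=\sum_{j\ge1}x_jb^{-j}$, $y=\sum_{j\ge1}y_jb^{-j}$ with digits in $Z_b$, $x\oplus y$ (resp. $x\ominus y$) has digits $x_j+y_j$ (resp. $x_j-y_j$) reduced mod $b$ to $Z_b$; for vectors coordinatewise. For integers $0\le n_1,n_2<b^m$, $n_1\oplus n_2:=b^m\big((n_1b^{-m})\oplus(n_2b^{-m})\big)$, similarly for $\ominus$. $E_m=\{kb^{-m}:0\le k<b^m\}$. **Discrepancy.** For $N$ points in the unit cube, $D^*((\beta_n)_{0\le n<N})=\sup_{0<y_1,\dots,y_s\le1}\big|\tfrac1N\#\{0\le n<N:\beta_n\in\prod_{i}[0,y_i)\}-y_1\cdots y_s\big|$. **Admissibility.** For $x=\sum_{j\ge1} x_jb^{-j}$ with $x_1=\dots=x_k=0$, $x_{k+1}\ne0$, $\|x\|_b=b^{-k-1}$, with $\|0\|_b=0$; $\|\mathbf x\|_b=\prod_i\|x^{(i)}\|_b$; for an integer $n\in[b^k,b^{k+1})$, $\|n\|_b=b^k$. A sequence is $d$-admissible in base $b$ if $\inf_{n>k\ge0}\|n\ominus k\|_b\|\mathbf x_n\ominus\mathbf x_k\|_b\ge b^{-d}$. *)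

(* Defs.v *)
From HB Require Import structures.
From mathcomp Require Import all_boot all_order all_algebra.
From mathcomp Require Import all_classical all_reals all_analysis.

Set Implicit Arguments.
Unset Strict Implicit.
Unset Printing Implicit Defensive.

Import Order.TTheory GRing.Theory Num.Theory.
Import numFieldNormedType.Exports.

Local Open Scope classical_set_scope.
Local Open Scope ring_scope.

Definition prime_power (b : nat) : Prop :=
  exists p e : nat, [/\ prime p, (0 < e)%N & b = (p ^ e)%N].

(* Z_b is rendered by 'Z_b, whose ring operations are reduction mod b; this is
   correct for 1 < b only, which holds for prime powers. *)

(* a_r(n) *)
Definition digit (b n r : nat) : 'Z_b := inZp (n %/ b ^ r).

(* A number of [0,1] is carried by a digit sequence, which need not be its
   canonical expansion; index j holds the digit of weight b^-(j+1). *)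
Definition expansion (b : nat) := nat -> 'Z_b.

Definition value (R : realType) (b : nat) (x : expansion b) : R :=
  limn (series (fun j => (x j : nat)%:R / b%:R ^+ j.+1 : R)).

Definition digit_point (b s : nat) := 'I_s -> expansion b.

Definition point_value (R : realType) (b s : nat) (x : digit_point b s)
  : 'I_s -> R :=
  fun i => value R (x i).

Definition point_add (b s : nat) (x y : digit_point b s) : digit_point b s :=
  fun i j => x i j + y i j.

Definition point_sub (b s : nat) (x y : digit_point b s) : digit_point b s :=
  fun i j => x i j - y i j.

(* Since n < b ^ n for b > 1, the digits of n1 and n2 of index at least
   maxn n1 n2 vanish: the sums below have all the nonzero terms, and so agree
   with b^m ((n1 b^-m) (+) (n2 b^-m)) for every m such that n1, n2 < b^m. *)
Definition nat_add (b n1 n2 : nat) : nat :=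
  (\sum_(r < maxn n1 n2) (digit b n1 r + digit b n2 r)%R * b ^ r)%N.

Definition nat_sub (b n1 n2 : nat) : nat :=
  (\sum_(r < maxn n1 n2) (digit b n1 r - digit b n2 r)%R * b ^ r)%N.

(* The (finite) expansion of k b^-m, for k < b^m. *)
Definition frac_expansion (b m k : nat) : expansion b :=
  fun j => if (j < m)%N then digit b k (m - j.+1) else 0.

Definition Egrid (b m : nat) : set (expansion b) :=
  [set frac_expansion b m k | k in [set k | (k < b ^ m)%N]].

(* The sum over r has finite support because n < b ^ n. *)
Definition digital_seq (b s : nat) (F : finFieldType) (phi : 'Z_b -> F)
    (phiV : F -> 'Z_b) (C : 'I_s -> nat -> nat -> F) : nat -> digit_point b s :=
  fun n i j => phiV (\sum_(r < n) C i j r * phi (digit b n r)).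

Definition digital (b s : nat) (F : finFieldType) (phi : 'Z_b -> F)
    (phiV : F -> 'Z_b) (x : nat -> digit_point b s) : Prop :=
  exists C : 'I_s -> nat -> nat -> F, x = digital_seq phi phiV C.

Definition in_elementary (R : realType) (b s : nat) (a d : 'I_s -> nat)
    (x : 'I_s -> R) : bool :=
  [forall i, (a i)%:R / b%:R ^+ d i <= x i < (a i).+1%:R / b%:R ^+ d i].

Definition elementary_volume (R : realType) (b s : nat) (d : 'I_s -> nat) : R :=
  \prod_(i < s) (b%:R ^- d i).

Definition is_net (R : realType) (b t m s : nat)
    (P : 'I_(b ^ m) -> 'I_s -> R) : Prop :=
  (t <= m)%N /\
  forall a d : 'I_s -> nat, (forall i, (a i < b ^ d i)%N) ->
    elementary_volume R b d = b%:R ^+ t / b%:R ^+ m ->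
    #|[set n | in_elementary b a d (P n)]%SET| = (b ^ t)%N.

Definition ts_sequence (R : realType) (b t s : nat) (x : nat -> digit_point b s)
  : Prop :=
  forall k m : nat, (t <= m)%N ->
    is_net t (fun n : 'I_(b ^ m) => point_value R (x (k * b ^ m + n)%N)).

Definition discrepancy (R : realType) (s : nat) (N : nat)
    (beta : nat -> 'I_s -> R) : R :=
  sup [set `| #|[set n : 'I_N | [forall i, 0 <= beta n i < y i]]%SET|%:R / N%:R
              - \prod_(i < s) y i |
      | y in [set y : 'I_s -> R | forall i, 0 < y i <= 1]].

Definition expansion_norm (R : realType) (b : nat) (x : expansion b) : R :=
  if pselect (exists j, x j != 0) is left nz
  then b%:R ^- (ex_minn nz).+1 else 0.

Definition point_norm (R : realType) (b s : nat) (x : digit_point b s) : R :=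
  \prod_(i < s) expansion_norm R (x i).

Definition nat_norm (b n : nat) : nat :=
  if n == 0%N then 0%N else (b ^ trunc_log b n)%N.

Definition admissible (R : realType) (b d s : nat) (x : nat -> digit_point b s)
  : Prop :=
  b%:R ^- d <=
  inf [set v : R | exists n k : nat, (k < n)%N /\
         v = (nat_norm b (nat_sub b n k))%:R
             * point_norm R (point_sub (x n) (x k))].

(* Rows and columns of infinite matrices are numbered from 0. *)
Definition upper_left (F : finFieldType) (D : nat -> nat -> F) (m : nat)
  : 'M[F]_m := \matrix_(i < m, j < m) D i j.

Definition hmap (b : nat) (F : finFieldType) (phi : 'Z_b -> F)
    (phiV : F -> 'Z_b) (D : nat -> nat -> F) (m n : nat) : nat :=
  let h := (\row_(r < m) phi (digit b n r)) *m (upper_left D m)^T in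
  (\sum_(j < m) phiV (h ord0 j) * b ^ j)%N.

(* The inverse of hmap as a bijection of {0, .., b^m - 1}; the value 0 is never
   used when upper_left D m is nonsingular and n < b^m. *)
Definition hmap_inv (b : nat) (F : finFieldType) (phi : 'Z_b -> F)
    (phiV : F -> 'Z_b) (D : nat -> nat -> F) (m n : nat) : nat :=
  if [pick q : 'I_(b ^ m) | hmap phi phiV D m q == n] is Some q
  then nat_of_ord q else 0%N.

Definition m_seq (s d t k : nat) : nat :=
  (s ^ 2 * (d + t) * (2 ^ (2 * k + 2) - 1))%N.

(* max over 1 <= N <= M of N D^*; all the terms are nonnegative. *)
Definition max_discrepancy (R : realType) (s M : nat)
    (beta : nat -> 'I_s -> R) : R :=
  \big[Num.max/0]_(1 <= N < M.+1) (N%:R * discrepancy N beta).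

(* Q and w range over finite nonempty sets: the infimum is a minimum. *)
Definition min_max_discrepancy (R : realType) (b s m : nat)
    (x : nat -> digit_point b s) (hinv : nat -> nat) : R :=
  inf [set v : R | exists (Q : nat) (w : digit_point b s),
         [/\ (Q < b ^ m)%N, forall i, Egrid m (w i) &
             v = max_discrepancy (b ^ m)
                   (fun n => point_value R
                      (point_add (x (nat_add b (hinv n) Q)) w))]].

(* Main.v *)
Require Import Defs.
From HB Require Import structures.
From mathcomp Require Import all_boot all_order all_algebra.
From mathcomp Require Import all_classical all_reals all_analysis.
From mathcomp Require Import zify ring lra.

(** Fix a scale k and put q = 4^k, m = m_k. The discrepancy of the shifted
    points z_n, 0 <= n < N, is measured on one anchored box, whose upper corner
    is a point of the set: for a suitable index c < b^m, N keeps the digits of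
    c of large weight, and the side of the box keeps the first digits of z_c
    (the same in every coordinate). The region below such a corner is a disjoint
    union of cells, one for each choice of a digit index r of N and digit indices
    J_i of the sides: there the counting coordinate first drops below N at r and
    coordinate i first drops below the side at J_i. Put S = sum of the J_i + 1.

    A cell with S + t <= r holds exactly its share of points, by the net property
    of the sequence. A cell with S > r + d is empty, by admissibility: its points
    agree with c and z_c up to the positions r and J_i exactly, which is too
    close. In between nothing is known, so the digits of the corner are chosen
    such that no such cell occurs: the sides have their digits 1 at multiples of
    s (d + t) only, so that S is a multiple of s (d + t), and the digits of N
    vanish at the d + t indices r around each multiple where S + t <= r and
    S > r + d both fail. Hence the count never exceeds the volume, and each empty
    cell contributes its full volume to the deficit. With the digit of N equal to
    b - 1 at r = S - d - 1, each of the q^s possible choices of the J_i loses at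
    least (b - 1) b^(-d-1). This is corner_bound; the constants of the theorem
    follow from m_k <= q K.

    It remains to find c. Its first digits in all coordinates are linear
    conditions on the digits of h^-1(c) (+) Q, and they may determine the low
    digits of that integer completely; so some low digits of c could not be
    prescribed if n and h^-1(n) were equal. The matrix gives the freedom back.
    It is unitriangular, with at most one further entry per row, in a column
    p r > r: digit r of n is then, up to the bijection phi, the sum of the digits
    r and p r of h^-1(n), where p r is one of the top indices, on which the
    coordinate conditions leave the digits free. The addition of Q acts digitwise
    but not linearly over the field, so it is essential that the digit p r be
    still unconstrained once digit r is known: pairing_fixed picks the p r one by
    one so that this holds. The rows concerned at different scales are disjoint,
    so one matrix serves all k (prescribes_all).

    Unitriangularity makes h preserve the index of the leading digit in which two
    integers differ (hmap_lead), hence h^-1 maps blocks of length b^m onto blocks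
    and preserves the norm of differences: admissibility and the net property
    carry over to the rearranged sequence. *)

Set Implicit Arguments.
Unset Strict Implicit.
Unset Printing Implicit Defensive.

Import Order.TTheory GRing.Theory Num.Theory.
Import numFieldNormedType.Exports.

Local Open Scope ring_scope.

(** * Digits of natural numbers *)

#[local] Arguments digit : simpl never.

Section Digits.
Context (b : nat) (b_gt1 : (1 < b)%N).

Lemma Zp_trunc_b : (Zp_trunc b).+2 = b.
Proof. exact: Zp_cast. Qed.

Lemma ltn_Zb (c : 'Z_b) : (c < b)%N.
Proof. by rewrite -[X in (_ < X)%N]Zp_trunc_b; exact: ltn_ord. Qed.

Lemma digitE n r : (digit b n r : nat) = (n %/ b ^ r %% b)%N.
Proof. by rewrite /digit /= Zp_trunc_b. Qed.

Lemma digit_small n r : (n < b ^ r)%N -> digit b n r = 0.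
Proof. by move=> h; apply: ord_inj; rewrite digitE divn_small // mod0n. Qed.

Lemma digit0 r : digit b 0 r = 0.
Proof. by rewrite digit_small // expn_gt0 ltnW. Qed.

Lemma digit_high m n r : (n < b ^ m)%N -> (m <= r)%N -> digit b n r = 0.
Proof.
move=> nm mr; apply: digit_small; apply: leq_trans nm _.
by rewrite leq_exp2l.
Qed.

Definition of_digits (m : nat) (f : nat -> 'Z_b) : nat :=
  (\sum_(r < m) f r * b ^ r)%N.

Lemma of_digitsS m f : of_digits m.+1 f = (of_digits m f + f m * b ^ m)%N.
Proof. exact: big_ord_recr. Qed.

Lemma of_digits_lt m f : (of_digits m f < b ^ m)%N.
Proof.
elim: m => [|m IH]; first by rewrite /of_digits big_ord0.
rewrite of_digitsS expnS.
have := ltn_Zb (f m); have : (0 < b ^ m)%N by rewrite expn_gt0; lia.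
nia.
Qed.

Lemma digit_of_digits m f r :
  digit b (of_digits m f) r = if (r < m)%N then f r else 0.
Proof.
case: ltnP => [|mr]; last exact: digit_high (of_digits_lt m f) mr.
elim: m => // m IH; rewrite ltnS leq_eqVlt => /orP[/eqP->|rm].
  apply: ord_inj; rewrite digitE of_digitsS divnDMl ?expn_gt0; last by lia.
  by rewrite divn_small ?of_digits_lt // add0n modn_small // ltn_Zb.
apply: ord_inj; rewrite -(IH rm) !digitE of_digitsS.
have -> : (f m * b ^ m = f m * b ^ (m - r.+1) * b * b ^ r)%N.
  by rewrite -!mulnA -!expnS -expnD subnK.
by rewrite divnDMl ?expn_gt0 1?ltnW // addnC modnMDl.
Qed.

Lemma digit_divn n a r : digit b (n %/ b ^ a)%N r = digit b n (a + r).
Proof. by apply: ord_inj; rewrite !digitE -divnMA expnD. Qed.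

Lemma of_digitsK m n : (n < b ^ m)%N -> of_digits m (digit b n) = n.
Proof.
elim: m n => [|m IH] n; first by rewrite expn0 ltnS leqn0 /of_digits big_ord0 => /eqP.
move=> nm; rewrite /of_digits big_ord_recl expn0 muln1 digitE expn0 divn1.
rewrite [RHS](divn_eq n b) addnC; congr (_ + _)%N.
rewrite -[in RHS](IH (n %/ b)%N); last by rewrite ltn_divLR ?(ltnW b_gt1) // -expnSr.
rewrite /of_digits big_distrl; apply: eq_bigr => r _.
have := digit_divn n 1 r; rewrite expn1 => ->.
by transitivity (digit b n r.+1 * (b ^ r * b))%N; [rewrite -expnSr | rewrite mulnA].
Qed.

Lemma ltn_expn n : (n < b ^ n)%N.
Proof. exact: ltn_expl. Qed.

Lemma digit_inj n k : digit b n =1 digit b k -> n = k.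
Proof.
move=> e; pose m := maxn n k.
have lt a : (a <= m)%N -> (a < b ^ m)%N.
  by move=> am; apply: leq_ltn_trans am (ltn_expn m).
rewrite -(@of_digitsK m n) ?lt ?leq_maxl // -(@of_digitsK m k) ?lt ?leq_maxr //.
by apply: eq_bigr => r _; rewrite e.
Qed.

Lemma ltn_expP n m : (forall r, (m <= r)%N -> digit b n r = 0) -> (n < b ^ m)%N.
Proof.
move=> h; suff -> : n = of_digits m (digit b n) by exact: of_digits_lt.
by apply: digit_inj => r; rewrite digit_of_digits; case: ltnP => // /h.
Qed.

Lemma digit_block K m n r : (n < b ^ m)%N ->
  digit b (K * b ^ m + n) r =
    if (r < m)%N then digit b n r else digit b K (r - m).
Proof.
move=> nm; case: ltnP => rm.
  apply: ord_inj; rewrite !digitE.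
  have -> : (K * b ^ m = K * b ^ (m - r.+1) * b * b ^ r)%N.
    by rewrite -!mulnA -!expnS -expnD subnK.
  by rewrite divnMDl ?expn_gt0 1?ltnW // modnMDl.
rewrite -[in LHS](subnKC rm) -digit_divn divnMDl ?expn_gt0; last by rewrite ltnW.
by rewrite divn_small ?addn0.
Qed.

Lemma digit_nat_add n k r : digit b (nat_add b n k) r = digit b n r + digit b k r.
Proof.
rewrite -[nat_add b n k]/(of_digits (maxn n k) (fun r => digit b n r + digit b k r)).
rewrite digit_of_digits.
case: ltnP => // h; rewrite !(digit_high _ h) ?addr0 //.
  by apply: leq_ltn_trans (leq_maxr n k) (ltn_expn _).
by apply: leq_ltn_trans (leq_maxl n k) (ltn_expn _).
Qed.

Lemma digit_nat_sub n k r : digit b (nat_sub b n k) r = digit b n r - digit b k r.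
Proof.
rewrite -[nat_sub b n k]/(of_digits (maxn n k) (fun r => digit b n r - digit b k r)).
rewrite digit_of_digits.
case: ltnP => // h; rewrite !(digit_high _ h) ?subr0 //.
  by apply: leq_ltn_trans (leq_maxr n k) (ltn_expn _).
by apply: leq_ltn_trans (leq_maxl n k) (ltn_expn _).
Qed.

(** The norm of the digitwise difference of n and k depends on this index alone,
    and h, its inverse and the shifts by Q all preserve it. *)
Definition lead (n k r : nat) : Prop :=
  digit b n r != digit b k r /\ forall r', (r < r')%N -> digit b n r' = digit b k r'.

Lemma lead_sym n k r : lead n k r -> lead k n r.
Proof. by case=> h1 h2; split=> [|r' /h2]; rewrite 1?eq_sym. Qed.

Lemma lead_uniq n k r r' : lead n k r -> lead n k r' -> r = r'.
Proof.
move=> [h1 h2] [h3 h4]; case: (ltngtP r r') => // lt.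
  by rewrite h2 ?eqxx in h3.
by rewrite h4 ?eqxx in h1.
Qed.

Lemma lead_neq n k r : lead n k r -> n <> k.
Proof. by case=> + _ e; rewrite e eqxx. Qed.

Lemma lead_ex n k : n <> k -> exists r, lead n k r.
Proof.
move=> nk; pose m := maxn n k.
have hi r : (m <= r)%N -> digit b n r = digit b k r.
  move=> mr; rewrite !(@digit_high m) //.
    by apply: leq_ltn_trans (leq_maxr n k) (ltn_expn _).
  by apply: leq_ltn_trans (leq_maxl n k) (ltn_expn _).
have ex : exists r, digit b n r != digit b k r.
  apply: contra_notP nk => h; apply: digit_inj => r.
  by apply/eqP/negPn/negP => hr; apply: h; exists r.
have bd r : digit b n r != digit b k r -> (r <= m)%N.
  by rewrite leqNgt; apply: contraNN => /ltnW /hi ->.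
exists (ex_maxn ex bd); case: ex_maxnP => r h1 h2; split=> // r' rr'.
apply/eqP/negPn/negP => /h2; lia.
Qed.

Lemma divn_lead n k r : (forall r', (r <= r')%N -> digit b n r' = digit b k r') ->
  (n %/ b ^ r = k %/ b ^ r)%N.
Proof. by move=> h; apply: digit_inj => r'; rewrite !digit_divn h // leq_addr. Qed.

Lemma lead_lt n k r : lead n k r -> (digit b n r < digit b k r)%N -> (n < k)%N.
Proof.
move=> [_ h]; rewrite !digitE => hd.
have e : (n %/ b ^ r %/ b = k %/ b ^ r %/ b)%N.
  by rewrite -!divnMA -!expnSr; apply: divn_lead.
have lt : (n %/ b ^ r < k %/ b ^ r)%N.
  by rewrite (divn_eq (n %/ b ^ r) b) (divn_eq (k %/ b ^ r) b) e ltn_add2l.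
by rewrite ltnNge; apply: contraTN lt => kn; rewrite -leqNgt leq_div2r.
Qed.

Lemma lt_lead n k : (n < k)%N ->
  exists r, lead n k r /\ (digit b n r < digit b k r)%N.
Proof.
move=> nk; have [r l] : exists r, lead n k r by apply: lead_ex; lia.
exists r; split=> //; case: (ltngtP (digit b n r) (digit b k r)) => // [gt|eq].
  by have := lead_lt (lead_sym l) gt; lia.
by case: l => /eqP h _; case: h; apply: ord_inj.
Qed.

Lemma nat_norm_lead n k r : lead n k r -> nat_norm b (nat_sub b n k) = (b ^ r)%N.
Proof.
move=> [h1 h2]; set X := nat_sub b n k.
have Xr : digit b X r != 0 by rewrite digit_nat_sub subr_eq0.
have X0 : X != 0%N by apply: contraNneq Xr => ->; rewrite digit_small ?expn_gt0 1?ltnW.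
rewrite /nat_norm (negbTE X0); congr (b ^ _)%N; apply: trunc_log_eq => //.
apply/andP; split; first by rewrite leqNgt; apply: contraNN Xr => /digit_small->.
by apply: ltn_expP => r' /h2; rewrite digit_nat_sub => ->; rewrite subrr.
Qed.

End Digits.

(** * Values of expansions *)

Section Values.
Context (R : realType) (b : nat) (b_gt1 : (1 < b)%N).
Implicit Types x y z : expansion b.

Definition psum x (m : nat) : R := \sum_(j < m) (x j : nat)%:R / b%:R ^+ j.+1.

Lemma b_gt0 : 0 < b%:R :> R.
Proof. by rewrite ltr0n ltnW. Qed.

Lemma expb_gt0 m : 0 < b%:R ^- m :> R.
Proof. by rewrite invr_gt0 exprn_gt0 ?b_gt0. Qed.

Lemma expbS m : b%:R ^- m = b%:R * b%:R ^- m.+1 :> R.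
Proof. by rewrite exprS invfM mulrA divff ?mul1r // gt_eqF ?b_gt0. Qed.

Lemma psumS x m : psum x m.+1 = psum x m + (x m : nat)%:R * b%:R ^- m.+1.
Proof. exact: big_ord_recr. Qed.

Lemma eq_psum x y m : (forall j, (j < m)%N -> x j = y j) -> psum x m = psum y m.
Proof. by move=> e; apply: eq_bigr => j _; rewrite e. Qed.

Lemma digit_le x m : (x m : nat)%:R <= b%:R - 1 :> R.
Proof. by rewrite lerBrDr natr1 ler_nat ltn_Zb. Qed.

Lemma digitN1 (c : 'Z_b) : c != -1 -> (c.+1 < b)%N.
Proof.
move=> h; have := ltn_Zb b_gt1 c; rewrite leq_eqVlt => /orP[/eqP e|//].
case/eqP: h; apply/eqP; rewrite -addr_eq0; apply/eqP/ord_inj => /=.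
rewrite (@modn_small 1) // addn1 e.
by transitivity (b %% b)%N; [rewrite Zp_trunc_b | exact: modnn].
Qed.

Lemma psum_mono x m m' : (m <= m')%N -> psum x m <= psum x m'.
Proof.
move=> /subnK <-; elim: (m' - m)%N => // a IH; rewrite addSn psumS.
by rewrite (le_trans IH) // lerDl mulr_ge0 // ltW ?expb_gt0.
Qed.

(** Digits b - 1 would leave this sum constant in m, and no digit is larger. *)
Lemma psum_tail x m m' : (m <= m')%N ->
  psum x m' + b%:R ^- m' <= psum x m + b%:R ^- m.
Proof.
move=> /subnK <-; elim: (m' - m)%N => // a IH; rewrite addSn psumS.
apply: le_trans IH; rewrite -addrA lerD2l [leRHS]expbS.
have := digit_le x (a + m); have := expb_gt0 (a + m).+1; nra.
Qed.

Lemma psum_tail_lt x m m' j : (m <= j < m')%N -> x j != -1 ->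
  psum x m' + b%:R ^- m' + b%:R ^- j.+1 <= psum x m + b%:R ^- m.
Proof.
move=> /andP[mj jm'] /digitN1 xj.
have h1 := psum_tail x mj; have h2 := psum_tail x jm'; rewrite psumS in h2.
have h3 : (x j : nat)%:R <= b%:R - 2 :> R.
  by rewrite lerBrDr -natrD ler_nat; lia.
have := expbS j; have := expb_gt0 j.+1; nra.
Qed.

Lemma psum_le1 x m : psum x m <= 1.
Proof.
have := psum_tail x (leq0n m); rewrite /psum big_ord0 expr0 invr1 add0r.
have := expb_gt0 m; rewrite /psum; lra.
Qed.

Lemma value_cvg x :
  cvgn (series (fun j => (x j : nat)%:R / b%:R ^+ j.+1 : R)).
Proof.
have e m : series (fun j => (x j : nat)%:R / b%:R ^+ j.+1 : R) m = psum x m.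
  by rewrite /series /= big_mkord.
apply: nondecreasing_is_cvgn => [m m' mm'|]; first by rewrite !e psum_mono.
by exists 1 => _ [m _ <-]; rewrite e psum_le1.
Qed.

Lemma value_ge x m : psum x m <= value R x.
Proof.
apply: limr_ge; first exact: value_cvg.
by near=> m'; rewrite /series /= big_mkord psum_mono //; near: m'; exact: nbhs_infty_ge.
Unshelve. all: by end_near. Qed.

(** A value reaches the right end of its b-adic interval only if all later
    digits are b - 1. *)
Lemma value_lt_tail x m j : (m <= j)%N -> x j != -1 ->
  value R x < psum x m + b%:R ^- m.
Proof.
move=> mj xj; apply: (@le_lt_trans _ _ (psum x m + b%:R ^- m - b%:R ^- j.+1)).
  apply: limr_le; first exact: value_cvg.
  near=> m'; rewrite /series /= big_mkord -/(psum x m').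
  have jm' : (m <= j < m')%N by rewrite mj; near: m'; exact: nbhs_infty_gt.
  have := psum_tail_lt jm' xj; have := expb_gt0 m'; lra.
by rewrite gtrBl expb_gt0.
Unshelve. all: by end_near. Qed.

Lemma least_diff (T : eqType) (x y : nat -> T) m :
  (exists j, (j < m)%N /\ x j != y j) ->
  exists j, [/\ (j < m)%N, x j != y j & forall j', (j' < j)%N -> x j' = y j'].
Proof.
move=> [j0 [j0m nj]]; have ex : exists j, x j != y j by exists j0.
exists (ex_minn ex); case: ex_minnP => j h1 h2; split=> //.
  exact: leq_ltn_trans (h2 _ nj) j0m.
by move=> j'; apply: contraTeq => /h2; rewrite -leqNgt.
Qed.

Lemma psum_lt x y j m : (j < m)%N -> (forall j', (j' < j)%N -> x j' = y j') ->
  (x j < y j)%N -> psum x m + b%:R ^- m <= psum y j.+1.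
Proof.
move=> jm e lt; apply: le_trans (psum_tail x jm) _.
rewrite !psumS (eq_psum e) -addrA lerD2l.
have : (x j : nat)%:R + 1 <= (y j : nat)%:R :> R by rewrite natr1 ler_nat.
have := expb_gt0 j.+1; nra.
Qed.

(** Values and digits are compared in one direction only: an expansion ending in
    digits b - 1 has the value of the next grid point, but no value lies below
    its own truncations. This bounds the number of points in a box from above. *)
Lemma value_lt_digits x y m : value R x < psum y m ->
  exists j, [/\ (j < m)%N, (x j < y j)%N & forall j', (j' < j)%N -> x j' = y j'].
Proof.
move=> lt; have [|j [jm nj e]] := @least_diff _ x y m.
  apply: contrapT => h; suff e : psum x m = psum y m.
    by have := value_ge x m; rewrite e; lra.
  apply: eq_psum => j jm; apply/eqP/negPn/negP => nj; apply: h; by exists j.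
exists j; split=> //; case: ltngtP => // [gt|eq]; last first.
  by case/eqP: nj; apply: ord_inj.
have := psum_lt jm (fun j' h => esym (e j' h)) gt.
have := expb_gt0 m; have := value_ge x j.+1; lra.
Qed.

(** The digit different from b - 1 keeps the value from being the left end of
    the next b-adic interval. *)
Lemma value_cell x z m : (exists2 j, (m <= j)%N & x j != -1) ->
  psum z m <= value R x -> value R x < psum z m + b%:R ^- m ->
  forall j, (j < m)%N -> x j = z j.
Proof.
move=> [j0 mj0 xj0] ge lt i im; apply/eqP/negPn/negP => ni.
have [|j [jm nj e]] := @least_diff _ x z m; first by exists i.
case: (ltngtP (x j) (z j)) => [lt'|gt'|eq]; last by case/eqP: nj; apply: ord_inj.
  have := psum_lt (ltnSn j) e lt'.
  have := value_lt_tail (leq_trans jm mj0) xj0; have := psum_mono z jm; lra.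
have := psum_lt jm (fun j' h => esym (e j' h)) gt'; have := value_ge x j.+1; lra.
Qed.

Lemma of_digits_psum z m :
  (of_digits m (fun r => z (m - r.+1)%N))%:R / b%:R ^+ m = psum z m.
Proof.
rewrite natr_sum mulr_suml (reindex_inj rev_ord_inj) /=.
apply: eq_bigr => j _; have jm := ltn_ord j.
have -> : (m - (m - j.+1).+1 = j)%N by lia.
rewrite natrM natrX -mulrA; congr (_ * _).
have -> : b%:R ^+ m = b%:R ^+ (m - j.+1) * b%:R ^+ j.+1 :> R.
  by rewrite -exprD subnK.
by rewrite invfM mulrA divff ?mul1r // expf_neq0 // gt_eqF ?b_gt0.
Qed.

Lemma expansion_norm_first x j : x j != 0 -> (forall j', (j' < j)%N -> x j' = 0) ->
  expansion_norm R x = b%:R ^- j.+1.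
Proof.
move=> nj e; rewrite /expansion_norm; case: pselect => [ex|]; last by case; exists j.
case: ex_minnP => i h1 h2; congr (_ ^- _.+1).
apply/eqP; rewrite eqn_leq h2 // leqNgt; apply: contraNN h1 => /e ->; exact/eqP.
Qed.

Lemma expansion_norm0 x : (forall j, x j = 0) -> expansion_norm R x = 0.
Proof.
move=> e; rewrite /expansion_norm; case: pselect => // h; exfalso.
by case: h => j; rewrite e eqxx.
Qed.

Lemma expansion_norm_ge0 x : 0 <= expansion_norm R x.
Proof. by rewrite /expansion_norm; case: pselect => // ?; rewrite ltW ?expb_gt0. Qed.
End Values.

(** * Admissible sequences *)

Section Admissible.
Context (R : realType) (b : nat) (b_gt1 : (1 < b)%N) (s d : nat).
Implicit Types x : nat -> digit_point b s.

Lemma expr_prod_expV (e : 'I_s -> nat) :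
  \prod_i b%:R ^- e i = b%:R ^- (\sum_i e i)%N :> R.
Proof. by rewrite prodfV expr_sum. Qed.

Lemma eq_expansion_norm (u v : expansion b) :
  (forall j, (u j == 0) = (v j == 0)) -> expansion_norm R u = expansion_norm R v.
Proof.
move=> e; case: (pselect (exists j, u j != 0)) => [[j0 uj0]|h].
  have [|j [_ uj /= u0]] := @least_diff _ u (fun=> 0) j0.+1; first by exists j0.
  rewrite (expansion_norm_first _ uj u0) (@expansion_norm_first _ _ v j) -?e //.
  by move=> j' /u0 uj'; apply/eqP; rewrite -e uj'.
have u0 j : u j == 0 by apply/negPn/negP => uj; apply: h; exists j.
by rewrite !expansion_norm0 // => j; apply/eqP; rewrite -?e.
Qed.

Lemma point_norm_subC (u v : digit_point b s) :
  point_norm R (point_sub u v) = point_norm R (point_sub v u).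
Proof.
apply: eq_bigr => i _; apply: eq_expansion_norm => j.
by rewrite /point_sub !subr_eq0 eq_sym.
Qed.

Lemma nat_norm_subC n k :
  nat_norm b (nat_sub b n k) = nat_norm b (nat_sub b k n).
Proof.
case: (pselect (n = k)) => [->//|/(lead_ex b_gt1)[r l]].
by rewrite (nat_norm_lead b_gt1 l) (nat_norm_lead b_gt1 (lead_sym l)).
Qed.

Lemma admissible_le x n k : admissible R d x -> n <> k ->
  b%:R ^- d <= (nat_norm b (nat_sub b n k))%:R
               * point_norm R (point_sub (x n) (x k)).
Proof.
move=> adm; wlog kn : n k / (k < n)%N => [hw nk|_].
  case: (ltngtP k n) => [kn|nk'|e]; [exact: hw| |by case: nk].
  by rewrite nat_norm_subC point_norm_subC; apply: hw => // /esym.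
apply: le_trans adm _; apply: ge_inf; last by exists n, k.
exists 0 => _ [n' [k' [_ ->]]]; rewrite mulr_ge0 // prodr_ge0 // => i _.
exact: expansion_norm_ge0.
Qed.

(** All factors of the product of norms are powers of b, so that admissibility
    compares exponents. *)
Lemma admissible_lead x n k r (J : 'I_s -> nat) :
  admissible R d x -> lead b n k r ->
  (forall i, x n i (J i) != x k i (J i)) ->
  (forall i j, (j < J i)%N -> x n i j = x k i j) ->
  (\sum_i (J i).+1 <= r + d)%N.
Proof.
move=> adm l nJ eJ; have := admissible_le adm (lead_neq l).
have -> : point_norm R (point_sub (x n) (x k)) = b%:R ^- (\sum_i (J i).+1)%N.
  rewrite -expr_prod_expV; apply: eq_bigr => i _.
  apply: expansion_norm_first; first by rewrite subr_eq0.
  by move=> j ji; rewrite /point_sub eJ ?subrr.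
rewrite (nat_norm_lead b_gt1 l) natrX -ler_pdivrMl ?exprn_gt0 ?b_gt0 //.
rewrite -invfM -exprD lef_pV2 ?posrE ?exprn_gt0 ?b_gt0 //.
by rewrite ler_eXn2l ?ltr1n.
Qed.

End Admissible.

(** * Digit prefixes of digital sequences *)

Section Digital.
Context (R : realType) (b : nat) (b_gt1 : (1 < b)%N) (s d t : nat).
Context (F : finFieldType) (phi : 'Z_b -> F) (phiV : F -> 'Z_b).
Context (phiVK : cancel phiV phi) (phi0 : phi 0 = 0).
Context (C : 'I_s -> nat -> nat -> F).

Let x := digital_seq phi phiV C.

(** The linear map behind the sequence: by phi, it sends the digits of n to those
    of x_n, when n < b^m. *)
Definition Cmul (m : nat) (v : nat -> F) (i : 'I_s) (j : nat) : F :=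
  \sum_(r < m) C i j r * v r.

Lemma Cmul_trunc m m' v i j : (m <= m')%N ->
  (forall r, (m <= r)%N -> v r = 0) -> Cmul m' v i j = Cmul m v i j.
Proof.
move=> mm' v0; rewrite /Cmul (big_ord_widen m' (fun r => C i j r * v r) mm').
rewrite [RHS]big_mkcond; apply: eq_bigr => r _; case: ltnP => // /v0 ->.
by rewrite mulr0.
Qed.

Lemma CmulD m u v i j : Cmul m (fun r => u r + v r) i j = Cmul m u i j + Cmul m v i j.
Proof. by rewrite -big_split; apply: eq_bigr => r _; rewrite mulrDr. Qed.

Lemma CmulZ m a v i j : Cmul m (fun r => a * v r) i j = a * Cmul m v i j.
Proof. by rewrite big_distrr; apply: eq_bigr => r _; rewrite mulrCA. Qed.

Lemma eq_Cmul m u v i j : (forall r, (r < m)%N -> u r = v r) ->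
  Cmul m u i j = Cmul m v i j.
Proof. by move=> e; apply: eq_bigr => r _; rewrite e. Qed.

Lemma phi_digital m n i j : (n < b ^ m)%N ->
  phi (x n i j) = Cmul m (fun r => phi (digit b n r)) i j.
Proof.
move=> nm; rewrite /x /digital_seq phiVK -[LHS]/(Cmul n (fun r => phi (digit b n r)) i j).
have z m' : (n < b ^ m')%N -> forall r, (m' <= r)%N -> phi (digit b n r) = 0.
  by move=> lt r le; rewrite (digit_high b_gt1 lt).
have /z zn := ltn_expn b_gt1 n.
case: (leqP m n) => [mn|/ltnW nm']; first by rewrite (Cmul_trunc i j mn (z m nm)).
by rewrite (Cmul_trunc i j nm' zn).
Qed.

Context (xadm : admissible R d x) (xts : ts_sequence R t x).

Lemma admissible_inj n k i : n <> k -> exists j, x n i j != x k i j.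
Proof.
move=> nk; apply: contrapT => h; have := admissible_le b_gt1 xadm nk.
rewrite /point_norm (bigD1 i) //= expansion_norm0; last first.
  move=> j; apply/eqP; rewrite subr_eq0; apply/negPn/negP => hj.
  by apply: h; exists j.
by rewrite mul0r mulr0 leNgt expb_gt0.
Qed.

(** Two sequence points whose i-th expansions share both their first m digits
    and an infinite tail of digits b - 1 coincide, so at most b^m of them carry
    such a tail. *)
Lemma tail_finite i m :
  exists K, forall n, (K <= n)%N -> exists2 j, (m <= j)%N & x n i j != -1.
Proof.
pose bad n := forall j, (m <= j)%N -> x n i j = -1.
pose P (f : {ffun 'I_m -> 'Z_b}) n := bad n /\ forall j : 'I_m, x n i j = f j.
pose g f := if pselect (exists n, P f n) is left ex then (projT1 (cid ex)).+1 else 0%N.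
exists (\max_f g f) => n le; apply: contrapT => h.
have bn : bad n.
  move=> j mj; apply/eqP/negPn/negP => hj; apply: h; by exists j.
pose f := [ffun j : 'I_m => x n i j].
have : (g f <= n)%N by apply: leq_trans le; exact: leq_bigmax.
rewrite /g; case: pselect => [ex|]; last first.
  by case; exists n; split=> // j; rewrite ffunE.
case: cid => n' [bn' fn'] /= n'n.
have [|j] := @admissible_inj n n' i; first by lia.
case: (ltnP j m) => [jm|mj]; last by rewrite bn // bn' // eqxx.
by have := fn' (Ordinal jm); rewrite ffunE /= => ->; rewrite eqxx.
Qed.

(** The net property counts values, whereas digits are wanted here. Far out in the
    sequence no point ends in digits b - 1, so in a block of b^m points placed
    there, a point in the elementary interval of a prefix has this prefix. The
    digits of the block number contribute a constant, absorbed in the target. *)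
Lemma prefix_surj_eq m (e : 'I_s -> nat) (z : 'I_s -> nat -> F) :
  (\sum_i e i + t = m)%N ->
  exists v, forall i j, (j < e i)%N -> Cmul m v i j = z i j.
Proof.
move=> em.
have [K hK] : exists K, forall i n, (K <= n)%N ->
    exists2 j, (e i <= j)%N & x n i j != -1.
  have /choice[f hf] i := tail_finite i (e i).
  exists (\max_i f i) => i n le; apply: hf; apply: leq_trans le; exact: leq_bigmax.
pose kb := (K * b ^ m)%N.
have dk r n : (n < b ^ m)%N ->
    phi (digit b (kb + n) r) = phi (digit b n r) + phi (digit b kb r).
  move=> nm; rewrite /kb -[in RHS](addn0 (K * b ^ m)%N) !digit_block ?expn_gt0 ?(ltnW b_gt1) //.
  case: ltnP => rm; first by rewrite digit0 // phi0 addr0.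
  by rewrite (digit_high b_gt1 nm rm) phi0 add0r.
pose c := Cmul (K + m) (fun r => phi (digit b kb r)).
pose y i : expansion b := fun j => phiV (z i j + c i j).
pose a i := of_digits (e i) (fun r => y i (e i - r.+1)%N).
have tm : (t <= m)%N by rewrite -em leq_addl.
have [_ net] := xts K tm.
have vol : elementary_volume R b e = b%:R ^+ t / b%:R ^+ m.
  rewrite /elementary_volume expr_prod_expV -em exprD invfM mulrCA.
  by rewrite divff ?mulr1 // expf_neq0 // gt_eqF // b_gt0.
have /eqP := net a e (fun i => of_digits_lt b_gt1 _ _) vol.
have : (0 < b ^ t)%N by rewrite expn_gt0 ltnW.
move=> + /eqP card; rewrite -card => /card_gt0P[n]; rewrite inE => /forallP cell.
exists (fun r => phi (digit b n r)) => i j ji.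
have nb : (kb + n < b ^ (K + m))%N.
  have := ltn_ord n; have := ltn_expn b_gt1 K; rewrite expnD /kb; nia.
have xy : x (kb + n)%N i j = y i j.
  have := cell i; rewrite /point_value -[(K * _)%N]/kb => /andP[h1 h2].
  apply: (@value_cell R _ b_gt1 _ _ (e i)) => //.
  - apply: (hK i); rewrite /kb; have : (0 < b ^ m)%N by rewrite expn_gt0 ltnW.
    nia.
  - by rewrite -of_digits_psum.
  - by rewrite -of_digits_psum // -[X in _ + X]mul1r -mulrDl natr1.
have := phi_digital i j nb; rewrite xy /y phiVK.
under [X in _ = X -> _]eq_Cmul => r _ do rewrite dk //.
rewrite CmulD => /(addIr _) ->.
by rewrite (Cmul_trunc _ _ (leq_addl K m)) // => r mr; rewrite (digit_high b_gt1 _ mr).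
Qed.

Lemma prefix_surj m (e : 'I_s -> nat) (z : 'I_s -> nat -> F) :
  (0 < s)%N -> (\sum_i e i + t <= m)%N ->
  exists v, forall i j, (j < e i)%N -> Cmul m v i j = z i j.
Proof.
move=> s0 em; pose i0 := Ordinal s0.
pose e' i := (e i + (i == i0) * (m - (\sum_i e i + t)))%N.
have [|v hv] := @prefix_surj_eq m e' z.
  rewrite big_split /= -big_distrl /=.
  have -> : (\sum_(i < s) (i == i0) = 1)%N.
    by rewrite (bigD1 i0) //= big1 // => i /negbTE ->.
  by rewrite mul1n addnAC subnKC.
by exists v => i j ji; apply: hv; rewrite /e' ltn_addr.
Qed.

Context (cardF : #|F| = b).

(** The prefix map is linear and onto, so translations by a section make all its
    fibres the same size. *)
Lemma fiber_card r (e : 'I_s -> nat) (z : 'I_s -> nat -> F) :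
  (0 < s)%N -> (\sum_i e i + t <= r)%N ->
  (#|[set v : {ffun 'I_r -> F} | [forall i, forall j : 'I_(e i),
       (\sum_(r' < r) C i j r' * v r' == z i j)%R]]| * b ^ (\sum_i e i) <= b ^ r)%N.
Proof.
move=> s0 er; set S := finset _.
pose I := {i : 'I_s & 'I_(e i)}.
pose G := {ffun I -> F}.
have /choice[sec hsec] (g : G) : exists v : {ffun 'I_r -> F}, forall i (j : 'I_(e i)),
    \sum_(r' < r) C i j r' * v r' = g (Tagged (fun i => 'I_(e i)) j).
  pose zg i j := if insub j is Some j' then g (@Tagged _ i (fun i => 'I_(e i)) j') else 0.
  have [v hv] := @prefix_surj r e zg s0 er.
  exists [ffun r' : 'I_r => v r'] => i j.
  under eq_bigr => r' _ do rewrite ffunE.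
  rewrite -[LHS]/(Cmul r v i j) hv // /zg; case: insubP => [j' _ e'|]; last by rewrite ltn_ord.
  by congr (g (Tagged _ _)); apply: ord_inj.
pose f (p : {ffun 'I_r -> F} * G) : {ffun 'I_r -> F} := [ffun r' => p.1 r' + sec p.2 r'].
have inj : {in finset.setX S [set: G]%SET &, injective f}.
  move=> [v g] [v' g']; rewrite !inE /= !andbT => /forallP vS /forallP vS' /ffunP ff.
  have gg : g = g'.
    apply/ffunP => -[i j].
    have /forallP/(_ j)/eqP vj := vS i; have /forallP/(_ j)/eqP vj' := vS' i.
    rewrite -[existT _ _ _]/(Tagged (fun i => 'I_(e i)) j) -!hsec.
    apply: (addrI (z i j)); rewrite -{1}vj -vj' -!big_split /=.
    by apply: eq_bigr => r' _; have := ff r'; rewrite !ffunE /= -!mulrDr => ->.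
  congr pair => //; apply/ffunP => r'; have := ff r'.
  by rewrite !ffunE /= gg => /addIr.
have := @leq_card_in _ _ f _ inj.
rewrite card_ffun card_ord cardF finset.cardsX cardsT card_ffun cardF card_tagged.
by rewrite sumnE big_map big_enum /=; under eq_bigr => i _ do rewrite card_ord.
Qed.

End Digital.

(** * Solving for paired digits *)

Section Solve.
Context (F : finFieldType) (I : Type) (lin : (nat -> F) -> I -> F).
Context (linD : forall u v i, lin (fun r => u r + v r) i = lin u i + lin v i).
Context (linZ : forall a v i, lin (fun r => a * v r) i = a * lin v i).
Context (tau m : nat).
Context (lin_onto : forall z g, exists v,
  lin v =1 z /\ forall r, (tau <= r < m)%N -> v r = g r).

Definition free (X : seq nat) : Prop :=
  forall z f, exists v, lin v =1 z /\ {in X, v =1 f}.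

Definition in_kernel (X : seq nat) (v : nat -> F) : Prop :=
  lin v =1 (fun=> 0 : F) /\ {in X, v =1 fun=> 0 : F}.

Lemma kernel_sub X u v : lin u =1 lin v -> {in X, u =1 v} ->
  in_kernel X (fun r => u r - v r).
Proof.
move=> luv uv; split=> [i|r rX]; last by rewrite uv ?subrr.
have -> : (fun r => u r - v r) = (fun r => u r + (-1) * v r).
  by apply: funext => r; rewrite mulN1r.
by rewrite linD linZ luv mulN1r subrr.
Qed.

Lemma free_cons X p v : free X -> in_kernel X v -> v p != 0 -> free (p :: X).
Proof.
move=> frX [lv vX] vp z f; have [u [lu uX]] := frX z f.
exists (fun r => u r + (f p - u p) / v p * v r); split=> [i|r].
  by rewrite linD linZ lu lv /= mulr0 addr0.
rewrite inE => /predU1P[->|rX]; last by rewrite (uX r) // (vX r) //= mulr0 addr0.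
by rewrite divfK // addrC subrK.
Qed.

(** Coordinates tau, .., m - 1 can be prescribed together with the value of
    lin, hence fewer than m - tau further conditions leave one of them free:
    this is the pigeonhole principle. *)
Lemma free_coordinate X : (size X < m - tau)%N ->
  exists p v, [/\ (tau <= p < m)%N, in_kernel X v & v p != 0].
Proof.
move=> szX.
have /choice[w hw] (g : {ffun 'I_(m - tau) -> F}) : exists v, lin v =1 (fun=> 0 : F) /\
    forall r : 'I_(m - tau), v (tau + r)%N = g r.
  pose g' r := if insub (r - tau)%N is Some r' then g r' else 0.
  have [v [lv hv]] := lin_onto (fun=> 0) g'.
  exists v; split=> // r; rewrite hv; last by have := ltn_ord r; lia.
  by rewrite /g' addKn valK.
pose res (g : {ffun 'I_(m - tau) -> F}) := [ffun i : 'I_(size X) => w g (nth 0%N X i)].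
have : ~ injective res.
  move=> /leq_card; rewrite !card_ffun !card_ord leq_exp2l; first by rewrite leqNgt szX.
  exact: card_finNzRing_gt1.
move=> /existsNP[g] /existsNP[g'] /not_implyP[/ffunP e ne].
have [r hr] : exists r, g r != g' r.
  apply: contra_notP ne => h; apply/ffunP => r; apply/eqP/negPn/negP => hr.
  by apply: h; exists r.
exists (tau + r)%N, (fun c => w g c - w g' c); split.
- by have := ltn_ord r; lia.
- apply: kernel_sub => [i|c cX]; first by rewrite (hw g).1 (hw g').1.
  have ci : (index c X < size X)%N by rewrite index_mem.
  by have := e (Ordinal ci); rewrite !ffunE /= nth_index.
- by rewrite (hw g).2 (hw g').2 subr_eq0.
Qed.

(** Here psi r is the effect of a digit shift on coordinate r, a bijection that is
    not linear. A row with p r <= r has no partner coordinate. *)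
Definition solves (bad : seq nat) (p : nat -> nat) (psi : nat -> F -> F)
    (target v : nat -> F) : Prop :=
  {in bad, forall r, psi r (v r) + (if (r < p r)%N then psi (p r) (v (p r)) else 0)
                     = target r}.

(** The rows are treated one after the other; X collects the coordinates already
    used. If coordinate r can still vary, its value is chosen so as to meet the
    target. If not, it is determined by lin and by the coordinates in X, so that
    psi r (v r) is a constant, and the value of a free coordinate p r >= tau
    compensates for it, because psi (p r) is onto. As each row uses up one
    coordinate, free_coordinate applies at every step. *)
Lemma pairing_fixed (bad : seq nat) :
  uniq bad -> {in bad, forall r, r < tau}%N -> (size bad <= m - tau)%N ->
  exists (X : seq nat) (p : nat -> nat),
    [/\ (size X <= size bad)%N, free X,
        {in bad, forall r, (r < p r)%N -> (p r < m)%N} &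
        forall psi psiV z target, (forall r, cancel (psiV r) (psi r)) ->
          exists f, forall v, lin v =1 z -> {in X, v =1 f} ->
            solves bad p psi target v].
Proof.
elim: bad => [_ _ _|r bad IH /= /andP[rbad ubad] ltau szb].
  exists [::], (fun=> 0%N); split=> //; last by move=> psi psiV z f _; exists f.
  by move=> z f; have [v [lv _]] := lin_onto z f; exists v.
have [c cb|X [p [szX frX pm hp]]] := IH ubad _ (ltnW szb).
  by apply: ltau; rewrite inE cb orbT.
pose upd (T : Type) (f : nat -> T) a y c := if c == a then y else f c.
have inXN v c : in_kernel X v -> v c != 0 -> c \notin X.
  by move=> [_ vX]; apply: contraNN => /vX ->.
have badr c : c \in bad -> (c == r) = false.
  by move=> cb; apply: contraNF rbad => /eqP <-.
have [[v0 [kv0 v0r]]|det] := pselect (exists v, in_kernel X v /\ v r != 0).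
  exists (r :: X), (upd nat p r 0%N); split=> //=.
  - exact: free_cons kv0 v0r.
  - move=> c; rewrite inE /upd; case: eqP => //= _; exact: pm.
  move=> psi psiV z target psiVK; have [f hf] := hp psi psiV z target psiVK.
  exists (upd F f r (psiV r (target r))) => v lv vX c.
  have vr : v r = psiV r (target r) by rewrite vX ?mem_head // /upd eqxx.
  rewrite inE /upd; case: (eqVneq c r) => /= [-> _|_ cb]; first by rewrite vr psiVK addr0.
  apply: (hf v) => // a aX; rewrite vX ?inE ?aX ?orbT // /upd.
  by case: eqP aX => // ->; rewrite (negbTE (inXN _ _ kv0 v0r)).
have [p0 [v0 [/andP[tp0 p0m] kv0 v0p]]] := free_coordinate (leq_ltn_trans szX szb).
have rp0 : (r < p0)%N by apply: leq_trans tp0; apply: ltau; rewrite mem_head.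
exists (p0 :: X), (upd nat p r p0); split=> //=.
- exact: free_cons kv0 v0p.
- move=> c; rewrite inE /upd; case: eqP => //= _; exact: pm.
move=> psi psiV z target psiVK; have [f hf] := hp psi psiV z target psiVK.
have [u [lu uX]] := frX z f.
pose y := psiV p0 (target r - psi r (u r)).
exists (upd F f p0 y) => v lv vX.
have vX' : {in X, v =1 f}.
  move=> a aX; rewrite vX ?inE ?aX ?orbT // /upd.
  by case: eqP aX => // ->; rewrite (negbTE (inXN _ _ kv0 v0p)).
have vp0 : v p0 = y by rewrite vX ?mem_head // /upd eqxx.
have vr : v r = u r.
  apply/eqP; rewrite -subr_eq0; apply/negPn/negP => h; apply: det.
  exists (fun c => v c - u c); split=> //; apply: kernel_sub => [i|a aX].
    by rewrite lv lu.
  by rewrite vX' ?uX.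
move=> c; rewrite inE /upd; case: (eqVneq c r) => /= [-> _|_ cb]; last exact: (hf v).
by rewrite rp0 vp0 vr psiVK addrC subrK.
Qed.

Lemma pairing_exists (bad : seq nat) :
  uniq bad -> {in bad, forall r, r < tau}%N -> (size bad <= m - tau)%N ->
  exists p : nat -> nat,
    {in bad, forall r, (r < p r)%N -> (p r < m)%N} /\
    forall psi psiV z target, (forall r, cancel (psiV r) (psi r)) ->
      exists v, lin v =1 z /\ solves bad p psi target v.
Proof.
move=> ub lb sb; have [X [p [_ frX pm hp]]] := pairing_fixed ub lb sb.
exists p; split=> // psi psiV z target psiVK.
have [f hf] := hp psi psiV z target psiVK; have [v [lv vX]] := frX z f.
by exists v; split=> //; exact: hf.
Qed.

End Solve.

(** * Rearrangement by a unitriangular matrix *)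

Section Unitriangular.
Context (b : nat) (b_gt1 : (1 < b)%N).
Context (F : finFieldType) (phi : 'Z_b -> F) (phiV : F -> 'Z_b).
Context (phiK : cancel phi phiV) (phiVK : cancel phiV phi) (phi0 : phi 0 = 0).
Context (D : nat -> nat -> F).
Context (D_low : forall i j, (j < i)%N -> D i j = 0) (D_diag : forall i, D i i = 1).

Let hm := hmap phi phiV D.
Let hinv n := hmap_inv phi phiV D n n.

Lemma upper_left_unit m : upper_left D m \in unitmx.
Proof.
rewrite unitmxE -det_tr det_trig.
  by rewrite big1 ?unitr1 // => i _; rewrite !mxE D_diag.
by apply/is_trig_mxP => i j ij; rewrite !mxE D_low.
Qed.

Lemma hmapE m n :
  hm m n = of_digits m (fun j => phiV (\sum_(r < m) D j r * phi (digit b n r))).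
Proof.
rewrite /hm /hmap; apply: eq_bigr => j _; congr (nat_of_ord (phiV _) * _)%N.
by rewrite mxE; apply: eq_bigr => r _; rewrite !mxE mulrC.
Qed.

Lemma hmap_lt m n : (hm m n < b ^ m)%N.
Proof. by rewrite hmapE of_digits_lt. Qed.

Lemma phi_digit_hmap m n j : (j < m)%N ->
  phi (digit b (hm m n) j) = \sum_(r < m) D j r * phi (digit b n r).
Proof. by move=> jm; rewrite hmapE digit_of_digits // jm phiVK. Qed.

(** Row r of D involves the digits of index at least r only, with coefficient 1 at
    digit r, so the first difference from the top stays where it is. *)
Lemma hmap_lead m n k r : (n < b ^ m)%N -> (k < b ^ m)%N ->
  lead b n k r -> lead b (hm m n) (hm m k) r.
Proof.
move=> nm km [nr er].
have rm : (r < m)%N.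
  by rewrite ltnNge; apply: contraNN nr => mr; rewrite !(digit_high b_gt1 _ mr).
have inj := can_inj phiK.
split=> [|r' rr']; last first.
  case: (ltnP r' m) => mr'; last by rewrite !(digit_high b_gt1 _ mr') // hmap_lt.
  apply: inj; rewrite !phi_digit_hmap //; apply: eq_bigr => a _.
  by case: (ltnP a r') => ar'; [rewrite D_low // !mul0r | rewrite er // (leq_trans rr')].
apply: contraNneq nr => /(congr1 phi); rewrite !phi_digit_hmap //.
rewrite (bigD1 (Ordinal rm)) //= [X in _ = X](bigD1 (Ordinal rm)) //= D_diag !mul1r.
rewrite (eq_bigr (fun a : 'I_m => D r a * phi (digit b k a))).
  by move=> /addIr /inj ->.
move=> a ar; case: (ltngtP a r) => h; first by rewrite D_low // !mul0r.
  by rewrite er.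
by case/eqP: ar; apply: ord_inj.
Qed.

(** As the digits of n of index at least m vanish, the larger blocks of D act on n
    like the block of size m; the inverses for different m agree for this reason. *)
Lemma hmap_stable m m' n : (n < b ^ m)%N -> (m <= m')%N -> hm m' n = hm m n.
Proof.
move=> nm mm'; apply: (digit_inj b_gt1) => j; apply: (can_inj phiK).
have zn r : (m <= r)%N -> phi (digit b n r) = 0.
  by move=> mr; rewrite (digit_high b_gt1 nm mr).
case: (ltnP j m') => jm'; last first.
  by rewrite !(@digit_high b b_gt1 m') // ?hmap_lt // (leq_trans (hmap_lt _ _)) // leq_exp2l.
rewrite phi_digit_hmap //; case: (ltnP j m) => jm; last first.
  rewrite (digit_high b_gt1 (hmap_lt m n) jm) phi0 big1 // => r _.
  by case: (ltnP r j) => rj; [rewrite D_low ?mul0r | rewrite zn ?mulr0 // (leq_trans jm)].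
rewrite phi_digit_hmap // (big_ord_widen m' (fun r => D j r * phi (digit b n r)) mm').
rewrite [RHS]big_mkcond; apply: eq_bigr => r _; case: ltnP => // /zn ->.
by rewrite mulr0.
Qed.

Lemma hmap_inj m n k : (n < b ^ m)%N -> (k < b ^ m)%N -> hm m n = hm m k -> n = k.
Proof.
move=> nm km e; apply: contrapT => /(lead_ex b_gt1)[r l].
by have := lead_neq (hmap_lead nm km l).
Qed.

Lemma hmap_invP m n : (n < b ^ m)%N ->
  (hmap_inv phi phiV D m n < b ^ m)%N /\ hm m (hmap_inv phi phiV D m n) = n.
Proof.
move=> nm; pose f (q : 'I_(b ^ m)) := Ordinal (hmap_lt m q).
have finj : injective f.
  by move=> q q' [] /hmap_inj e; apply: ord_inj; apply: e.
rewrite /hmap_inv; case: pickP => [q /eqP h|]; first by rewrite ltn_ord.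
move=> /(_ (invF finj (Ordinal nm))); have := f_invF finj (Ordinal nm).
by move=> [] e; rewrite -/hm e eqxx.
Qed.

Lemma hmap_inv_stable m n : (n < b ^ m)%N -> hmap_inv phi phiV D m n = hinv n.
Proof.
move=> nm; have nn := ltn_expn b_gt1 n.
have [l1 e1] := hmap_invP nm; have [l2 e2] := hmap_invP nn.
have le a : (a <= maxn m n)%N -> (b ^ a <= b ^ maxn m n)%N by rewrite leq_exp2l.
apply: (@hmap_inj (maxn m n)).
- exact: leq_trans l1 (le _ (leq_maxl m n)).
- exact: leq_trans l2 (le _ (leq_maxr m n)).
by rewrite (hmap_stable l1) ?leq_maxl // (hmap_stable l2) ?leq_maxr // e1.
Qed.

Lemma hinvP m n : (n < b ^ m)%N -> (hinv n < b ^ m)%N /\ hm m (hinv n) = n.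
Proof. by move=> nm; rewrite -(hmap_inv_stable nm); exact: hmap_invP. Qed.

Lemma hinv_uniq m q : (q < b ^ m)%N -> hinv (hm m q) = q.
Proof.
move=> qm; have [l e] := hinvP (hmap_lt m q).
exact: hmap_inj l qm e.
Qed.

Lemma hinv_lead n k r : lead b n k r -> lead b (hinv n) (hinv k) r.
Proof.
move=> l; pose m := maxn n k.
have nm : (n < b ^ m)%N by apply: leq_ltn_trans (leq_maxl n k) (ltn_expn b_gt1 _).
have km : (k < b ^ m)%N by apply: leq_ltn_trans (leq_maxr n k) (ltn_expn b_gt1 _).
have [hn en] := hinvP nm; have [hk ek] := hinvP km.
have [r' l'] : exists r', lead b (hinv n) (hinv k) r'.
  apply: lead_ex => // e; have := lead_neq l; by rewrite -en -ek e.
by have := hmap_lead hn hk l'; rewrite en ek => /(lead_uniq l) ->.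
Qed.

Context (R : realType) (s d t : nat) (x : nat -> digit_point b s).

Lemma admissible_hinv : admissible R d x -> admissible R d (fun n => x (hinv n)).
Proof.
move=> adm; apply: lb_le_inf.
  by exists ((nat_norm b (nat_sub b 1 0))%:R
     * point_norm R (point_sub (x (hinv 1)) (x (hinv 0)))), 1%N, 0%N.
move=> _ [n [k [kn ->]]].
have [r l] : exists r, lead b n k r by apply: lead_ex => //; lia.
rewrite (nat_norm_lead b_gt1 l) -(nat_norm_lead b_gt1 (hinv_lead l)).
by apply: admissible_le => //; exact: lead_neq (hinv_lead l).
Qed.

(** Integers that agree in all digits of index at least m are mapped to integers
    with the same property, so hinv maps blocks of length b^m onto such blocks. *)
Lemma ts_sequence_hinv : ts_sequence R t x -> ts_sequence R t (fun n => x (hinv n)).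
Proof.
move=> ts k m tm.
have bm0 : (0 < b ^ m)%N by rewrite expn_gt0 ltnW.
pose K := (hinv (k * b ^ m) %/ b ^ m)%N.
have hK n : (n < b ^ m)%N -> (hinv (k * b ^ m + n) %/ b ^ m = K)%N.
  move=> nm; apply: divn_lead => // r mr.
  have e r' : (m <= r')%N -> digit b (k * b ^ m + n) r' = digit b (k * b ^ m) r'.
    move=> mr'; rewrite -[in RHS](addn0 (k * b ^ m)%N) !digit_block //.
    by rewrite ltnNge mr'.
  have [->//|/(lead_ex b_gt1)[a l]] := pselect (k * b ^ m + n = k * b ^ m)%N.
  apply: (hinv_lead l).2; apply: leq_trans mr; rewrite ltnNge.
  by apply: contraNN l.1 => /e ->.
have lt n : (hinv (k * b ^ m + n) %% b ^ m < b ^ m)%N by rewrite ltn_mod.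
pose f (n : 'I_(b ^ m)) := Ordinal (lt n).
have fE (n : 'I_(b ^ m)) : hinv (k * b ^ m + n) = (K * b ^ m + f n)%N.
  by rewrite {1}(divn_eq (hinv (k * b ^ m + n)) (b ^ m)) hK.
have finj : injective f.
  move=> n n' /(congr1 val) /= e; apply: ord_inj; apply: contrapT => nn'.
  have [r l] : exists r, lead b (k * b ^ m + n) (k * b ^ m + n') r.
    by apply: lead_ex => // /addnI.
  by apply: (lead_neq (hinv_lead l)); rewrite !fE /= e.
have [_ net] := ts K m tm; split=> // a e ae vol.
rewrite -(net a e ae vol) -!sum1dep_card [RHS](reindex_inj finj) /=.
by apply: eq_bigl => n; rewrite fE modnMDl modn_small.
Qed.

End Unitriangular.

(** * Lower bounds for the discrepancy *)

Section Discrepancy.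
Context (R : realType) (s : nat).

Lemma discrepancy_ge (N : nat) (beta : nat -> 'I_s -> R) (y : 'I_s -> R) :
  (forall i, 0 < y i <= 1) -> (0 < N)%N ->
  N%:R * \prod_i y i - #|[set n : 'I_N | [forall i, 0 <= beta n i < y i]]%SET|%:R
  <= N%:R * discrepancy N beta.
Proof.
move=> y01 N0; have N0' : 0 < N%:R :> R by rewrite ltr0n.
set c := #|_|%:R.
rewrite [leRHS]mulrC -ler_pdivrMr // mulrBl mulrAC divff ?mul1r ?gt_eqF //.
apply: (@le_trans _ _ `|c / N%:R - \prod_i y i|); first by rewrite distrC ler_norm.
apply: ub_le_sup; last by exists y.
exists 2 => _ [u u01 <-].
have card_le (A : {set 'I_N}) : #|A|%:R / N%:R <= 1 :> R.
  by rewrite ler_pdivrMr // mul1r ler_nat -[leqRHS]card_ord max_card.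
have u0 : 0 <= \prod_i u i by apply: prodr_ge0 => i _; case/andP: (u01 i) => /ltW.
have u1 : \prod_i u i <= 1.
  by apply: prodr_ile1 => i _; case/andP: (u01 i) => /ltW -> ->.
set k := #|_|; have k1 : k%:R / N%:R <= 1 := card_le _.
have k0 : 0 <= k%:R / N%:R :> R by rewrite divr_ge0.
by rewrite ler_norml; apply/andP; split; lra.
Qed.

Lemma max_discrepancy_ge (M N : nat) (beta : nat -> 'I_s -> R) :
  (0 < N <= M)%N -> N%:R * discrepancy N beta <= max_discrepancy M beta.
Proof.
move=> /andP[N0 NM]; rewrite /max_discrepancy.
apply: (@le_bigmax_seq _ _ _ _ _ N xpredT (fun N => N%:R * discrepancy N beta)) => //.
by rewrite mem_index_iota N0.
Qed.

End Discrepancy.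

(** * The deficit below a corner *)

Lemma card_cover_le (U I : finType) (A : {set U}) (B : I -> {set U}) :
  (forall a, a \in A -> exists i, a \in B i) -> (#|A| <= \sum_i #|B i|)%N.
Proof.
move=> AB; apply: (@leq_trans (\sum_(a in A) \sum_i (a \in B i))).
  rewrite -sum1_card; apply: leq_sum => a /AB[i aB].
  by rewrite (bigD1 i) //= aB.
rewrite exchange_big; apply: leq_sum => i _ /=; rewrite -sum1_card.
rewrite big_mkcond [leqRHS]big_mkcond; apply: leq_sum => a _.
by case: (a \in A) => //; case: (a \in B i).
Qed.

Section Corner.
Context (R : realType) (b : nat) (b_gt1 : (1 < b)%N) (s d t : nat) (s_gt0 : (0 < s)%N).
Context (F : finFieldType) (phi : 'Z_b -> F) (phiV : F -> 'Z_b).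
Context (phiK : cancel phi phiV) (phiVK : cancel phiV phi) (phi0 : phi 0 = 0).
Context (cardF : #|F| = b).
Context (C : 'I_s -> nat -> nat -> F).

Let x := digital_seq phi phiV C.

Context (xadm : admissible R d x) (xts : ts_sequence R t x).

Context (T : nat -> nat) (m : nat).
Context (T_lead : forall n k r, lead b n k r -> lead b (T n) (T k) r).
Context (T_lt : forall n, (n < b ^ m)%N -> (T n < b ^ m)%N).

Lemma T_inj n k : T n = T k -> n = k.
Proof.
by move=> e; apply: contrapT => /(lead_ex b_gt1)[r /T_lead /lead_neq].
Qed.

Lemma T_agree n k r : (forall r', (r <= r')%N -> digit b n r' = digit b k r') ->
  forall r', (r <= r')%N -> digit b (T n) r' = digit b (T k) r'.
Proof.
move=> e r' rr'; have [->//|/(lead_ex b_gt1)[a l]] := pselect (n = k).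
apply: (T_lead l).2; apply: leq_trans rr'; rewrite ltnNge.
by apply: contraNN l.1 => /e ->.
Qed.

(** Agreement in the digits of index at least r passes from n to T n, so the
    points counted lie in one fibre of the prefix map on r digits. *)
Lemma block_card (N r : nat) (J : 'I_s -> nat) (u : 'I_s -> nat -> 'Z_b)
    (A : {set 'I_N}) :
  (N <= b ^ m)%N -> (r <= m)%N -> (\sum_i (J i).+1 + t <= r)%N ->
  {in A &, forall n n' : 'I_N, forall r', (r <= r')%N -> digit b n r' = digit b n' r'} ->
  {in A, forall (n : 'I_N) i j, (j <= J i)%N -> x (T n) i j = u i j} ->
  (#|A| * b ^ (\sum_i (J i).+1) <= b ^ r)%N.
Proof.
move=> Nm rm Jr topA prefA.
case: (set_0Vmem A) => [->|[n0 An0]]; first by rewrite cards0 mul0n.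
pose low n r' := if (r' < r)%N then phi (digit b (T n) r') else 0.
pose high n r' := if (r' < r)%N then 0 else phi (digit b (T n) r').
have splitT n r' : phi (digit b (T n) r') = low n r' + high n r'.
  by rewrite /low /high; case: ifP => _; rewrite ?addr0 ?add0r.
pose z i j := phi (u i j) - Cmul C m (high n0) i j.
pose f (n : 'I_N) := [ffun r' : 'I_r => phi (digit b (T n) r')].
have inj : {in A &, injective f}.
  move=> n n' An An' /ffunP e; apply: ord_inj; apply: T_inj.
  apply: (digit_inj b_gt1) => r'; case: (ltnP r' r) => rr'.
    by have := e (Ordinal rr'); rewrite !ffunE => /(can_inj phiK).
  exact: (T_agree (topA _ _ An An')).
rewrite -(card_in_imset inj).
apply: leq_trans (fiber_card b_gt1 phiVK phi0 xadm xts cardF z s_gt0 Jr).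
rewrite leq_mul2r; apply/orP; right; apply: subset_leq_card.
apply/fintype.subsetP => _ /imsetP[n An ->]; rewrite inE.
apply/forallP => i; apply/forallP => j; apply/eqP.
have nm : (T n < b ^ m)%N by apply: T_lt; apply: leq_trans Nm.
have := phi_digital b_gt1 phiVK phi0 C i j nm.
rewrite -/x (prefA n An) -1?ltnS //.
under [X in _ = X -> _]eq_Cmul => r' _ do rewrite splitT.
rewrite CmulD (@eq_Cmul _ _ C m (high n) (high n0)); last first.
  move=> r' _; rewrite /high; case: ltnP => // rr'.
  by rewrite (T_agree (topA _ _ An An0)).
rewrite /z => ->; rewrite addrK (Cmul_trunc _ _ _ rm); last first.
  by move=> r' rr'; rewrite /low ltnNge rr'.
by apply: eq_bigr => r' _; rewrite ffunE /low ltn_ord.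
Qed.

Context (w : digit_point b s).
Let z n := point_add (x (T n)) w.

Context (L N corner : nat) (y : expansion b).
Context (y01 : forall j, y j = 0 \/ y j = 1).
Context (N_lt : (N < b ^ m)%N).
Context (corner_top : forall r, digit b N r != 0 ->
  forall r', (r <= r')%N -> digit b corner r' = digit b N r').
Context (corner_pos : forall i j, (j < L)%N -> z corner i j = y j).

(* The box [0, y)^s x [0, N) is the disjoint union of these cells: the first
   digit below the corner has index J i in coordinate i, and the leading one
   has index r in the counting coordinate. *)
Let in_cell r (J : 'I_s -> nat) (n : nat) : bool :=
  [&& (digit b n r < digit b N r)%N, `[< lead b n N r >] &
      [forall i, (z n i (J i) < y (J i))%N] &&
      [forall i, forall j : 'I_(J i), z n i j == y j]].

Let cell_count r J := #|[set n : 'I_N | in_cell r J n]%SET|.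

Let cell_size r (J : 'I_s -> nat) : R :=
  (digit b N r : nat)%:R * b%:R ^+ r * \prod_i ((y (J i) : nat)%:R / b%:R ^+ (J i).+1).

Lemma cell_size_ge0 r J : 0 <= cell_size r J.
Proof.
rewrite !mulr_ge0 ?exprn_ge0 ?ler0n //; apply: prodr_ge0 => i _.
by rewrite mulr_ge0 ?ler0n // ltW ?expb_gt0.
Qed.

Lemma in_cellP r J n : in_cell r J n ->
  [/\ (digit b n r < digit b N r)%N, lead b n N r,
      forall i, y (J i) = 1 /\ z n i (J i) = 0 &
      forall i j, (j < J i)%N -> z n i j = y j].
Proof.
move=> /and3P[h1 /asboolP h2 /andP[/forallP h3 /forallP h4]]; split=> // i.
  have := h3 i; case: (y01 (J i)) => -> // lt; split=> //; apply: ord_inj.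
  by apply/eqP; rewrite -leqn0.
by move=> j ji; have /forallP/(_ (Ordinal ji))/eqP := h4 i.
Qed.

Lemma cell_size1 r J : (forall i, y (J i) = 1) ->
  cell_size r J = (digit b N r : nat)%:R * b%:R ^+ r * b%:R ^- (\sum_i (J i).+1)%N.
Proof.
move=> yJ; rewrite /cell_size -expr_prod_expV; congr (_ * _).
by apply: eq_bigr => i _; rewrite yJ mul1r.
Qed.

(** The digits of y are 0 or 1, so a cell fixes a prefix in every coordinate; each
    value of the digit r of n below that of N then gives a single fibre. *)
Lemma cell_count_shallow r J : (r < m)%N -> (forall i, y (J i) = 1) ->
  (\sum_i (J i).+1 + t <= r)%N -> (cell_count r J)%:R <= cell_size r J.
Proof.
move=> rm yJ Jr; rewrite cell_size1 // ler_pdivlMr ?exprn_gt0 ?b_gt0 //.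
rewrite -!natrX -!natrM ler_nat.
pose B (c : 'I_(digit b N r)) := [set n : 'I_N | in_cell r J n && (digit b n r == c :> nat)]%SET.
have cover : (cell_count r J <= \sum_c #|B c|)%N.
  apply: card_cover_le => n; rewrite inE => cn; have [lt _ _ _] := in_cellP cn.
  by exists (Ordinal lt); rewrite inE cn /=.
apply: (leq_trans (leq_mul cover (leqnn _))); rewrite big_distrl /=.
apply: (@leq_trans (\sum_(c < digit b N r) b ^ r)); last by rewrite sum_nat_const card_ord.
apply: leq_sum => c _.
pose u i j := (if (j < J i)%N then y j else 0) - w i j.
apply: (@block_card N r J u); rewrite ?(ltnW N_lt) ?(ltnW rm) //.
  move=> n n'; rewrite !inE => /andP[/in_cellP[_ l _ _] /eqP e].
  move=> /andP[/in_cellP[_ l' _ _] /eqP e'] r'; rewrite leq_eqVlt => /orP[/eqP<-|rr'].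
    by apply: ord_inj; rewrite e e'.
  by rewrite l.2 ?l'.2.
move=> n; rewrite inE => /andP[/in_cellP[_ _ zJ zp] _] i j jJ.
apply/eqP; rewrite /u eq_sym subr_eq -[X in _ == X]/(z n i j).
by case: (ltngtP j (J i)) jJ => [/zp-> _|//|-> _]; rewrite ?(zJ i).2.
Qed.

(** A point of the cell leaves the corner exactly at the positions r and J i, too
    close for an admissible sequence. *)
Lemma cell_deep r J n : (forall i, (J i < L)%N) -> (r + d < \sum_i (J i).+1)%N ->
  ~~ in_cell r J n.
Proof.
move=> JL deep; apply/negP => /in_cellP[h1 h2 h3 h4].
have Nr : digit b N r != 0 by apply: contraTneq h1 => ->.
have l : lead b n corner r.
  split=> [|r' rr']; first by rewrite (corner_top Nr) ?h2.1.
  by rewrite (corner_top Nr (ltnW rr')) h2.2.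
have eqx i j n' : (z n i j == z n' i j) = (x (T n) i j == x (T n') i j).
  by rewrite /z /point_add (inj_eq (addIr _)).
have := @admissible_lead R b b_gt1 s d x (T n) (T corner) r J xadm (T_lead l).
rewrite leqNgt deep => h; apply/negP: isT; apply: h => [i|i j ji].
  rewrite -eqx corner_pos //; by have [-> ->] := h3 i; rewrite eq_sym oner_eq0.
by apply/eqP; rewrite -eqx corner_pos ?(h4 i) // (ltn_trans ji).
Qed.

Context (gap : forall (J : 'I_s -> nat) r,
  (forall i, (J i < L)%N /\ y (J i) = 1) -> digit b N r != 0 ->
  (\sum_i (J i).+1 + t <= r)%N \/ (r + d < \sum_i (J i).+1)%N).
Context (critical : forall J : 'I_s -> nat,
  (forall i, (J i < L)%N /\ y (J i) = 1) ->
  exists r, [/\ (r < m)%N, (r + d.+1 = \sum_i (J i).+1)%N & digit b N r = -1]).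

Lemma cell_count0 r J : (forall n, ~~ in_cell r J n) -> cell_count r J = 0%N.
Proof.
move=> h; apply/eqP; rewrite cards_eq0; apply/eqP/setP => n.
by rewrite !inE (negbTE (h n)).
Qed.

Lemma cell_count_le r J : (r < m)%N -> (forall i, (J i < L)%N) ->
  (cell_count r J)%:R <= cell_size r J.
Proof.
move=> rm JL; have [[n cn]|h] := pselect (exists n, in_cell r J n); last first.
  rewrite cell_count0 ?cell_size_ge0 // => n; apply/negP => cn.
  by apply: h; exists n.
have [lt _ yz _] := in_cellP cn.
have Nr : digit b N r != 0 by apply: contraTneq lt => ->.
have [shallow|deep] := gap (J := J) (fun i => conj (JL i) (yz i).1) Nr.
  by apply: cell_count_shallow => // i; exact: (yz i).1.
by have := cell_deep n JL deep; rewrite cn.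
Qed.

Lemma critical_cell J : (forall i, (J i < L)%N /\ y (J i) = 1) ->
  exists2 r, (r < m)%N &
    (b%:R - 1) * b%:R ^- d.+1 <= cell_size r J - (cell_count r J)%:R.
Proof.
move=> yJ; have [r [rm rJ Nr]] := critical yJ; exists r => //.
rewrite cell_count0 ?subr0; last first.
  move=> n; apply: cell_deep => [i|]; first exact: (yJ i).1.
  by rewrite -rJ addnS.
rewrite cell_size1 => [|i]; last exact: (yJ i).2.
have -> : (digit b N r : nat)%:R = b%:R - 1 :> R.
  rewrite Nr -[in RHS](Zp_trunc_b b_gt1) -natr1 addrK; congr (_%:R).
  by rewrite /= modn_small // subn1.
rewrite -mulrA ler_pM2l ?subr_gt0 ?ltr1n // -rJ exprD invfM mulrA divff ?mul1r //.
by rewrite expf_neq0 // gt_eqF ?b_gt0.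
Qed.

(** Expanding the product of N and the sides over their digits writes the expected
    number of points as a sum over cells. No cell exceeds its share, and for each
    admitted J the critical cell is empty. *)
Lemma corner_bound :
  (#|[set j : 'I_L | y j == 1]%SET| ^ s)%:R * ((b%:R - 1) * b%:R ^- d.+1)
  <= N%:R * \prod_(i < s) psum R y L -
     #|[set n : 'I_N | [forall i, 0 <= point_value R (z n) i < psum R y L]]%SET|%:R.
Proof.
pose A := [set n : 'I_N | [forall i, 0 <= point_value R (z n) i < psum R y L]]%SET.
rewrite -/A.
pose val_of (J : {ffun 'I_s -> 'I_L}) i : nat := J i.
have volume : N%:R * \prod_(i < s) psum R y L =
    \sum_(J : {ffun 'I_s -> 'I_L}) \sum_(r < m) cell_size r (val_of J).
  rewrite /psum bigA_distr_bigA /= mulr_sumr; apply: eq_bigr => J _.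
  rewrite -mulr_suml; congr (_ * _).
  rewrite -{1}(of_digitsK b_gt1 N_lt) natr_sum; apply: eq_bigr => r _.
  by rewrite natrM natrX.
have cover : (#|A| <= \sum_(p : {ffun 'I_s -> 'I_L} * 'I_m) cell_count p.2 (val_of p.1))%N.
  apply: (@card_cover_le _ _ A (fun p : {ffun 'I_s -> 'I_L} * 'I_m =>
    [set n : 'I_N | in_cell p.2 (val_of p.1) n]%SET)) => n.
  rewrite inE => /forallP inA.
  have [r [l lt]] := lt_lead b_gt1 (ltn_ord n).
  have rm : (r < m)%N.
    rewrite ltnNge; apply/negP => mr; move: lt.
    by rewrite (digit_high b_gt1 N_lt mr).
  have /choice[J hJ] i : exists j : 'I_L, (z n i j < y j)%N /\
      forall j', (j' < j)%N -> z n i j' = y j'.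
    have /andP[_ /(value_lt_digits b_gt1)[j [jL zy e]]] := inA i.
    by exists (Ordinal jL).
  exists ([ffun i => J i], Ordinal rm); rewrite inE; apply/and3P; split=> //=.
    exact/asboolP.
  apply/andP; split; apply/forallP => i; first by rewrite /val_of ffunE; exact: (hJ i).1.
  apply/forallP => -[j jJ] /=; apply/eqP; apply: (hJ i).2.
  by move: jJ; rewrite /val_of ffunE.
move: cover; rewrite -(ler_nat R) natr_sum.
rewrite -(pair_bigA _ (fun (J : {ffun 'I_s -> 'I_L}) (r : 'I_m) =>
  (cell_count r (val_of J))%:R)) /= => cover.
apply: le_trans (lerB (lexx _) cover); rewrite volume -sumrB.
pose good j := (y j == 1).
rewrite -sum1dep_card big_mkcond /=.
have -> : ((\sum_(j < L) if good j then 1 else 0) ^ s)%N =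
    (\sum_(J : {ffun 'I_s -> 'I_L}) \prod_i (if good (J i) then 1 else 0))%N.
  rewrite -(bigA_distr_bigA (fun (_ : 'I_s) (j : 'I_L) => if good j then 1%N else 0%N)).
  by rewrite prod_nat_const card_ord.
rewrite natr_sum mulr_suml; apply: ler_sum => J _; rewrite -sumrB.
have JL i : (val_of J i < L)%N by exact: ltn_ord.
have cell_ge0 (r : 'I_m) : 0 <= cell_size r (val_of J) - (cell_count r (val_of J))%:R.
  by rewrite subr_ge0 cell_count_le.
case: (boolP [forall i, good (J i)]) => [/forallP gJ|].
  have [i|r rm hr] := @critical_cell (val_of J); first by split; [|exact/eqP/gJ].
  rewrite big1 ?mul1r; last by move=> i _; rewrite gJ.
  apply: le_trans hr _; rewrite (bigD1 (Ordinal rm)) //= lerDl.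
  exact: sumr_ge0.
rewrite negb_forall => /existsP[i0 bad].
by rewrite (bigD1 i0) //= (negbTE bad) mul0n mul0r sumr_ge0.
Qed.

End Corner.

(** * Positions of the corner digits *)

Section Rows.
Local Open Scope nat_scope.
Context (s d t : nat) (s_ge2 : 2 <= s) (d_ge1 : 1 <= d).

(** The spacing exceeds d + t, which leaves room for the vanishing digits of N
    between two consecutive multiples. *)
Definition step := s * (d + t).

Lemma step_gt : d + t < step.
Proof. rewrite /step; nia. Qed.

Context (q : nat) (q_gt0 : 0 < q).

(** Length of the prescribed prefixes: the corner digits sit at the multiples of
    step with factors q, .., 2q - 1. *)
Definition depth := (2 * q).-1 * step.

(** This is m_k for q = 4^k, and s^2 (d + t) (q - 1) is the preceding m_(k-1). *)
Definition rows := s ^ 2 * (d + t) * (4 * q).-1.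

(** Around each possible sum S = step * sigma of corner positions: e = 0 is the
    index S - d - 1 of a critical cell, and 1 <= e <= d + t are the indices r with
    neither S + t <= r nor S > r + d. *)
Definition bad_rows : seq nat :=
  undup [seq step * sigma + e - d.+1 | sigma <- iota (s * q) (s * q.-1).+1,
                                       e <- iota 0 (d + t).+1].

Lemma bad_rowsP r :
  reflect (exists sigma e, [/\ s * q <= sigma <= s * (2 * q).-1, e <= d + t &
                               r = step * sigma + e - d.+1])
          (r \in bad_rows).
Proof.
rewrite mem_undup; apply: (iffP idP) => [/allpairsP[[sg e] [h1 h2 ->]]|[sg [e [h1 h2 ->]]]].
  exists sg, e; split=> //.
    move: h1; rewrite -[(sg, e).1]/sg mem_iota => /andP[-> h]; move: h.
    by case: q q_gt0 => // a _ /=; nia.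
  by move: h2; rewrite -[(sg, e).2]/e mem_iota.
apply: (allpairs_f (fun sg e => step * sg + e - d.+1)); rewrite mem_iota.
  by move: h1 => /andP[-> h] /=; case: q q_gt0 h => // a _ /=; nia.
by rewrite ltnS.
Qed.

(** The bad rows lie above all rows of the preceding scale. *)
Lemma bad_rows_ge r : r \in bad_rows -> s ^ 2 * (d + t) * q.-1 <= r.
Proof.
move=> /bad_rowsP[sg [e [/andP[h1 _] _ ->]]].
have h : step * (s * q) <= step * sg by rewrite leq_mul2l h1 orbT.
have e1 : step * (s * q) = s ^ 2 * (d + t) * q.-1 + s ^ 2 * (d + t).
  by rewrite -mulnSr prednK // /step; ring.
have : d.+1 <= s ^ 2 * (d + t) by nia.
lia.
Qed.

Lemma bad_rows_lt r : r \in bad_rows -> r < s * depth + t.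
Proof.
move=> /bad_rowsP[sg [e [/andP[_ h1] h2 ->]]].
have h : step * sg <= step * (s * (2 * q).-1) by rewrite leq_mul2l h1 orbT.
have e1 : step * (s * (2 * q).-1) = s * depth by rewrite /depth; ring.
have : 0 < s * depth by rewrite /depth /step !muln_gt0; lia.
lia.
Qed.

(** The coordinate conditions take about half of the m digits; the bad rows, a
    proportion 2 / s at most of the indices that they span, fit into the rest. *)
Lemma bad_rows_small : size bad_rows <= rows - (s * depth + t).
Proof.
apply: (leq_trans (size_undup _)); rewrite size_allpairs !size_iota /rows /depth /step.
case: q q_gt0 => // a _; rewrite -[a.+1.-1]/a.
have -> : (2 * a.+1).-1 = 2 * a + 1 by lia.
have -> : (4 * a.+1).-1 = 4 * a + 3 by lia.
have : (s * a).+1 * (d + t).+1 + s * ((2 * a + 1) * (s * (d + t))) + t <=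
  s ^ 2 * (d + t) * (4 * a + 3).
  set D := d + t; have D1 : 1 <= D by rewrite /D; lia.
  have tD : t <= D by rewrite /D; lia.
  have ss : 2 * s <= s ^ 2 by rewrite expnS expn1; nia.
  have : (s * a).+1 * D.+1 <= (s * a).+1 * (2 * D) by rewrite leq_mul2l; lia.
  have : (s * a).+1 * (2 * D) <= (a * s ^ 2 + 2) * D.
    rewrite mulnA leq_mul2r; apply/orP; right; nia.
  have -> : s * ((2 * a + 1) * (s * D)) = s ^ 2 * D * (2 * a + 1) by ring.
  have : 4 * D <= s ^ 2 * D by rewrite leq_mul2r; apply/orP; right; nia.
  set S := s ^ 2 * D; have -> : (a * s ^ 2 + 2) * D = a * S + 2 * D by rewrite /S; ring.
  nia.
lia.
Qed.

Lemma depth_le_rows : s * depth + t < rows.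
Proof.
have := bad_rows_small; set sz := size _ => h.
have : 0 < sz.
  have : step * (s * q) + 0 - d.+1 \in bad_rows.
    by apply/bad_rowsP; exists (s * q), 0; split=> //; case: q q_gt0 => //= a _; nia.
  by rewrite /sz; case: bad_rows.
lia.
Qed.

(** The digits 1 of the corner sit at the multiples of step; a sum of s such
    positions is again a multiple of step. *)
Definition corner_digit (j : nat) : bool := (step %| j.+1) && (q * step <= j.+1).

Lemma sum_corner_digits (J : 'I_s -> nat) :
  (forall i, J i < depth /\ corner_digit (J i)) ->
  exists2 sigma, s * q <= sigma <= s * (2 * q).-1 & \sum_i (J i).+1 = step * sigma.
Proof.
move=> hJ; have st : 0 < step by have := step_gt; lia.
exists (\sum_i (J i).+1 %/ step); last first.
  rewrite big_distrr; apply: eq_bigr => i _.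
  by have [_ /andP[h _]] := hJ i; rewrite /= mulnC divnK.
have [lo hi] : (forall i, q <= (J i).+1 %/ step) /\ (forall i, (J i).+1 %/ step <= (2 * q).-1).
  split=> i; have [h1 /andP[h2 h3]] := hJ i; first by rewrite leq_divRL.
  by rewrite -(leq_pmul2r st) divnK.
have const c : s * c = \sum_(i < s) c by rewrite sum_nat_const card_ord.
by rewrite !const !leq_sum.
Qed.

Lemma corner_digit_first : (q * step).-1 < depth /\ corner_digit (q * step).-1.
Proof.
have st := step_gt; rewrite /corner_digit /depth prednK ?muln_gt0 ?q_gt0; last by lia.
rewrite dvdn_mull // leqnn; split=> //; case: q q_gt0 => // a _; nia.
Qed.

Lemma card_corner_digits : q <= #|[set j : 'I_depth | corner_digit j]%SET|.
Proof.
have st : 0 < step by have := step_gt; lia.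
have lt (a : 'I_q) : ((q + a) * step).-1 < depth.
  rewrite /depth; have : 0 < (q + a) * step by rewrite muln_gt0; lia.
  have : (q + a) * step <= (2 * q).-1 * step by rewrite leq_mul2r; have := ltn_ord a; lia.
  lia.
pose f a := Ordinal (lt a).
have finj : injective f.
  move=> a a' /(congr1 val) /= e; apply: ord_inj.
  have : (q + a) * step = (q + a') * step.
    have : 0 < (q + a) * step by rewrite muln_gt0; lia.
    have : 0 < (q + a') * step by rewrite muln_gt0; lia.
    lia.
  by move/eqP; rewrite eqn_pmul2r // eqn_add2l => /eqP.
rewrite -[leqLHS]card_ord -(card_imset _ finj); apply: subset_leq_card.
apply/fintype.subsetP => _ /imsetP[a _ ->]; rewrite inE /corner_digit /=.
have pos : 0 < (q + a) * step by rewrite muln_gt0; lia.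
by rewrite prednK // dvdn_mull // leq_mul2r leq_addr orbT.
Qed.

End Rows.

(** * Choice of the matrix *)

Section Pairing.
Context (F : finFieldType) (p : nat -> nat).

(** A unit row wherever p i <= i. *)
Definition pairing_matrix (i j : nat) : F :=
  (i == j)%:R + ((i < j)%N && (j == p i))%:R.

Lemma pairing_matrix_low i j : (j < i)%N -> pairing_matrix i j = 0.
Proof.
move=> ji; rewrite /pairing_matrix (ltnNge i j) (ltnW ji) /= addr0.
by rewrite gtn_eqF.
Qed.

Lemma pairing_matrix_diag i : pairing_matrix i i = 1.
Proof. by rewrite /pairing_matrix eqxx ltnn addr0. Qed.

Lemma pairing_matrix_row m r (u : nat -> F) :
  (r < m)%N -> ((r < p r)%N -> (p r < m)%N) ->
  \sum_(j < m) pairing_matrix r j * u j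
    = u r + (if (r < p r)%N then u (p r) else 0).
Proof.
move=> rm pm; rewrite /pairing_matrix.
under eq_bigr => j _ do rewrite mulrDl.
rewrite big_split /=; congr (_ + _).
  rewrite (bigD1 (Ordinal rm)) //= eqxx mul1r big1 ?addr0 // => j jr.
  rewrite (_ : (r == j :> nat) = false) ?mul0r //.
  by apply: contraNF jr => /eqP e; apply/eqP/ord_inj.
case: ifP => rp; last first.
  rewrite big1 // => j _; case: eqP => [->|]; last by rewrite andbF mul0r.
  by rewrite rp mul0r.
rewrite (bigD1 (Ordinal (pm rp))) //= rp eqxx mul1r big1 ?addr0 // => j jp.
rewrite (_ : (j == p r :> nat) = false) ?andbF ?mul0r //.
by apply: contraNF jp => /eqP e; apply/eqP/ord_inj.
Qed.

End Pairing.

Section Stage.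
Context (R : realType) (b : nat) (b_gt1 : (1 < b)%N) (s d t : nat).
Context (s_ge2 : (2 <= s)%N) (d_ge1 : (1 <= d)%N).
Context (F : finFieldType) (phi : 'Z_b -> F) (phiV : F -> 'Z_b).
Context (phiVK : cancel phiV phi) (phi0 : phi 0 = 0).
Context (C : 'I_s -> nat -> nat -> F).

Let x := digital_seq phi phiV C.

Context (xadm : admissible R d x) (xts : ts_sequence R t x).

(** One choice of p serves all shifts Q, because psi is quantified after p. *)
Definition prescribes (q : nat) (p : nat -> nat) : Prop :=
  let m := rows s d t q in
  {in bad_rows s d t q, forall r, (r < p r)%N -> (p r < m)%N} /\
  forall psi psiV (z : 'I_s -> nat -> F) target, (forall r, cancel (psiV r) (psi r)) ->
    exists v, (forall i j, (j < depth s d t q)%N -> Cmul C m v i j = z i j) /\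
              solves (bad_rows s d t q) p psi target v.

Lemma prescribes_ex q : (0 < q)%N -> exists p, prescribes q p.
Proof.
move=> q0; set m := rows s d t q; set L := depth s d t q.
pose lin (v : nat -> F) (ij : 'I_s * 'I_L) := Cmul C m v ij.1 ij.2.
pose tau := (s * L + t)%N.
have tm : (tau <= m)%N by apply/ltnW/depth_le_rows.
have linD u v ij : lin (fun r => u r + v r) ij = lin u ij + lin v ij by exact: CmulD.
have linZ a v ij : lin (fun r => a * v r) ij = a * lin v ij by exact: CmulZ.
have onto z g : exists v, lin v =1 z /\ forall r, (tau <= r < m)%N -> v r = g r.
  pose high r := if (r < tau)%N then 0 else g r.
  pose z' i j := if insub j is Some j' then z (i, j') - lin high (i, j') else 0.
  have [||v hv] := @prefix_surj R b b_gt1 s d t F phi phiV phiVK phi0 C xadm xts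
                   tau (fun=> L) z'.
  - by lia.
  - by rewrite sum_nat_const card_ord.
  pose low r := if (r < tau)%N then v r else 0.
  exists (fun r => low r + high r); split=> [[i j]|r /andP[tr _]]; last first.
    by rewrite /low /high ltnNge tr add0r.
  rewrite linD {1}/lin /= (@Cmul_trunc _ _ _ tau) //; last first.
    by move=> r tr; rewrite /low ltnNge tr.
  rewrite (@eq_Cmul _ _ _ _ low v) => [|r rt]; last by rewrite /low rt.
  rewrite hv // /z' insubT ?ltn_ord //= => h.
  by rewrite (_ : Sub _ _ = j) ?subrK //; apply: ord_inj.
have [|||p [pm hp]] := @pairing_exists F _ lin linD linZ tau m onto (bad_rows s d t q).
- exact: undup_uniq.
- by move=> r; exact: bad_rows_lt.
- exact: bad_rows_small.
exists p; split=> // psi psiV z target psiVK.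
have [v [lv sv]] := hp psi psiV (fun ij => z ij.1 ij.2) target psiVK.
by exists v; split=> // i j jL; exact: (lv (i, Ordinal jL)).
Qed.

Lemma prescribes_eq q p p' : {in bad_rows s d t q, p =1 p'} ->
  prescribes q p -> prescribes q p'.
Proof.
move=> e [pm hp]; split=> [r rb|psi psiV z target psiVK].
  by rewrite -e //; exact: pm.
have [v [hv sv]] := hp psi psiV z target psiVK.
by exists v; split=> // r rb; rewrite -e // sv.
Qed.

(** The bad rows for the scales q = 4^k lie in disjoint intervals, so the choices
    of p for the single scales can be put together. *)
Lemma prescribes_all : exists p, forall k, prescribes (4 ^ k) p.
Proof.
have /choice[f hf] k : exists p, prescribes (4 ^ k) p.
  by apply: prescribes_ex; rewrite expn_gt0.
pose own k r := r \in bad_rows s d t (4 ^ k).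
have own_uniq k l r : own k r -> own l r -> k = l.
  wlog kl : k l / (k < l)%N => [hw ok ol|ok ol].
    by case: (ltngtP k l) => // h; [exact: hw | apply/esym; exact: hw].
  have := bad_rows_lt s_ge2 d_ge1 _ ok; have := depth_le_rows t (q := 4 ^ k) s_ge2 d_ge1.
  have := bad_rows_ge s_ge2 d_ge1 _ ol.
  have : (4 * 4 ^ k <= 4 ^ l)%N by rewrite -expnS leq_exp2l.
  rewrite !expn_gt0 /= => h1 h2 h3 h4.
  have := h2 isT; have := h3 isT; have := h4 isT.
  have : (rows s d t (4 ^ k) <= s ^ 2 * (d + t) * (4 ^ l).-1)%N.
    by rewrite leq_mul2l; lia.
  lia.
pose p r := if pselect (exists k, own k r) is left ex then f (projT1 (cid ex)) r else 0%N.
exists p => k; apply: prescribes_eq (hf k) => r rb.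
rewrite /p; case: pselect => [ex|]; last by case; exists k.
by case: cid => l /= ol; rewrite (own_uniq _ _ _ rb ol).
Qed.

Context (phiK : cancel phi phiV) (p : nat -> nat).
Let D : nat -> nat -> F := pairing_matrix F p.
Let hinv n := hmap_inv phi phiV D n n.

Lemma lead_nat_add Q n k r : lead b n k r -> lead b (nat_add b n Q) (nat_add b k Q) r.
Proof.
move=> [h1 h2]; split=> [|r' /h2 e]; rewrite !digit_nat_add // ?e //.
by rewrite (inj_eq (addIr _)).
Qed.

Lemma shifted_lead Q n k r : lead b n k r ->
  lead b (nat_add b (hinv n) Q) (nat_add b (hinv k) Q) r.
Proof.
move=> l; apply: lead_nat_add.
by apply: hinv_lead => //; [exact: pairing_matrix_low | exact: pairing_matrix_diag].
Qed.

Lemma shifted_lt m Q n : (Q < b ^ m)%N -> (n < b ^ m)%N ->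
  (nat_add b (hinv n) Q < b ^ m)%N.
Proof.
move=> Qm nm; apply: ltn_expP => // r mr; rewrite digit_nat_add //.
have [hm _] := hinvP b_gt1 phiK phiVK phi0 (@pairing_matrix_low F p) (@pairing_matrix_diag F p) nm.
by rewrite !(digit_high b_gt1 _ mr) ?addr0.
Qed.

(** With v the digits of the sequence index read in the field, psi subtracts the
    digits of Q, and row r of the matrix then yields digit r of n. *)
Lemma corner_exists q Q (w : digit_point b s) (y target : nat -> 'Z_b) :
  let m := rows s d t q in
  prescribes q p -> (0 < q)%N -> (Q < b ^ m)%N ->
  exists n, [/\ (n < b ^ m)%N,
    forall i j, (j < depth s d t q)%N ->
      point_add (x (nat_add b (hinv n) Q)) w i j = y j &
    {in bad_rows s d t q, forall r, digit b n r = target r}].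
Proof.
move=> m [pm hp] q0 Qm.
pose psi r u := phi (phiV u - digit b Q r).
pose psiV r u := phi (phiV u + digit b Q r).
have psiVK r : cancel (psiV r) (psi r) by move=> u; rewrite /psi /psiV phiK addrK phiVK.
have [v [hv sv]] := hp psi psiV (fun i j => phi (y j - w i j)) (phi \o target) psiVK.
pose n' := of_digits m (phiV \o v).
have n'm : (n' < b ^ m)%N by exact: of_digits_lt.
have dn' r : (r < m)%N -> digit b n' r = phiV (v r).
  by move=> rm; rewrite digit_of_digits // rm.
pose n0 := nat_sub b n' Q.
have n0m : (n0 < b ^ m)%N.
  by apply: ltn_expP => // r mr; rewrite digit_nat_sub // !(digit_high b_gt1 _ mr) ?subrr.
have D_low := @pairing_matrix_low F p; have D_diag := @pairing_matrix_diag F p.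
have hn0 : hinv (hmap phi phiV D m n0) = n0 by exact: hinv_uniq.
exists (hmap phi phiV D m n0); split=> [|i j jL|r rb].
- exact: hmap_lt.
- rewrite hn0.
  have -> : nat_add b n0 Q = n'.
    apply: (digit_inj b_gt1) => r.
    by rewrite digit_nat_add // digit_nat_sub // subrK.
  apply/eqP; rewrite /point_add eq_sym -subr_eq eq_sym; apply/eqP.
  apply: (can_inj phiK); rewrite (phi_digital b_gt1 phiVK phi0 C i j n'm) -hv //.
  by apply: eq_Cmul => r rm; rewrite dn' // phiVK.
- have rm : (r < m)%N.
    apply: leq_ltn_trans (depth_le_rows t s_ge2 d_ge1 q0); apply: ltnW.
    exact: bad_rows_lt rb.
  apply: (can_inj phiK); rewrite phi_digit_hmap //.
  rewrite (pairing_matrix_row (fun j => phi (digit b n0 j)) rm (pm r rb)).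
  rewrite -[RHS](sv r rb) /psi digit_nat_sub // dn' //; congr (_ + _).
  by case: ifP => // /(pm r rb) prm; rewrite digit_nat_sub // dn'.
Qed.

Context (cardF : #|F| = b).

Lemma stage_bound q Q (w : digit_point b s) :
  let m := rows s d t q in
  prescribes q p -> (0 < q)%N -> (Q < b ^ m)%N ->
  (q ^ s)%:R * ((b%:R - 1) * b%:R ^- d.+1)
  <= max_discrepancy (b ^ m)
       (fun n => point_value R (point_add (x (nat_add b (hinv n) Q)) w)).
Proof.
move=> m hp q0 Qm; have s0 : (0 < s)%N by exact: ltnW.
pose L := depth s d t q.
pose y : expansion b := fun j => if corner_digit s d t q j then 1 else 0.
pose target r : 'Z_b := if (step s d t %| r + d.+1)%N then -1 else 0.
have [nc [nc_lt nc_pos nc_rows]] :=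
  corner_exists w y target hp q0 Qm.
(* Below low nothing is known about the digits of the corner index: N drops
   them, so that every cell has r >= low. *)
pose low := (s ^ 2 * (d + t) * q.-1)%N.
pose N := of_digits m (fun r => if (r < low)%N then 0 else digit b nc r).
have digitN r : digit b N r = if (r < low)%N then 0 else digit b nc r.
  rewrite digit_of_digits //; case: (ltnP r m) => // mr.
  by rewrite (digit_high b_gt1 nc_lt mr) if_same.
have y1 j : y j = 1 -> corner_digit s d t q j.
  by rewrite /y; case: ifP => // _ /eqP; rewrite eq_sym oner_eq0.
have sumJ (J : 'I_s -> nat) : (forall i, (J i < L)%N /\ y (J i) = 1) ->
    exists2 sg, (s * q <= sg <= s * (2 * q).-1)%N & (\sum_i (J i).+1 = step s d t * sg)%N.
  by move=> hJ; apply: sum_corner_digits => // i; have [h1 /y1] := hJ i.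
have st := step_gt t s_ge2 d_ge1.
have step_sg sg : (s * q <= sg <= s * (2 * q).-1)%N -> (d < step s d t * sg)%N.
  move=> /andP[lo _]; have sg0 : (0 < sg)%N by apply: leq_trans lo; rewrite muln_gt0 s0.
  apply: (@leq_trans (step s d t)); last by rewrite leq_pmulr.
  exact: leq_ltn_trans (leq_addr t d) st.
have digit_bad sg e : (s * q <= sg <= s * (2 * q).-1)%N -> (e <= d + t)%N ->
    let r := (step s d t * sg + e - d.+1)%N in
    (r < m)%N /\ digit b N r = if e == 0%N then -1 else 0.
  move=> hsg he r.
  have rb : r \in bad_rows s d t q by apply/bad_rowsP => //; exists sg, e.
  split; first by apply: ltn_trans (depth_le_rows t s_ge2 d_ge1 q0); exact: bad_rows_lt rb.
  rewrite digitN ltnNge (bad_rows_ge s_ge2 d_ge1 q0 rb) /= nc_rows // /target.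
  have -> : (r + d.+1 = step s d t * sg + e)%N.
    by rewrite subnK // ltn_addr // step_sg.
  rewrite dvdn_addr; last exact: dvdn_mulr (dvdnn _).
  case: (eqVneq e 0%N) => [->|e0]; first by rewrite dvdn0.
  by rewrite gtnNdvd ?lt0n // (leq_ltn_trans he).
have y01 j : y j = 0 \/ y j = 1 by rewrite /y; case: ifP => _; [right|left].
have N_lt : (N < b ^ m)%N by exact: of_digits_lt.
have top r : digit b N r != 0 -> forall r', (r <= r')%N -> digit b nc r' = digit b N r'.
  rewrite digitN; case: (ltnP r low) => [|lr _ r' rr']; first by rewrite eqxx.
  by rewrite digitN ltnNge (leq_trans lr rr').
have gap (J : 'I_s -> nat) r : (forall i, (J i < L)%N /\ y (J i) = 1) ->
    digit b N r != 0 ->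
    (\sum_i (J i).+1 + t <= r)%N \/ (r + d < \sum_i (J i).+1)%N.
  move=> /sumJ[sg hsg ->] Nr; case: (leqP (step s d t * sg + t) r) => h1; first by left.
  right; rewrite ltnNge; apply: contraNN Nr => h2.
  have he : (r + d.+1 - step s d t * sg <= d + t)%N by lia.
  have [_] := digit_bad sg _ hsg he.
  have -> : (step s d t * sg + (r + d.+1 - step s d t * sg) - d.+1 = r)%N by lia.
  by move=> ->; rewrite ifF //; apply/negbTE; lia.
have critical (J : 'I_s -> nat) : (forall i, (J i < L)%N /\ y (J i) = 1) ->
    exists r, [/\ (r < m)%N, (r + d.+1 = \sum_i (J i).+1)%N & digit b N r = -1].
  move=> /sumJ[sg hsg ->]; have [rm Nr] := digit_bad sg 0%N hsg (leq0n _).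
  exists (step s d t * sg + 0 - d.+1)%N; split=> //.
  by rewrite addn0 subnK // step_sg.
have [j0L j0c] := corner_digit_first t s_ge2 d_ge1 q0.
have yj0 : y (q * step s d t).-1 = 1 by rewrite /y j0c.
have [r0 [_ _ Nr0]] := critical (fun=> (q * step s d t).-1) (fun=> conj j0L yj0).
have N_gt0 : (0 < N)%N.
  rewrite lt0n; apply: contraTneq isT => N0; move: Nr0; rewrite N0 digit0 //.
  by move/eqP; rewrite eq_sym oppr_eq0 oner_eq0.
have psum01 (i : 'I_s) : 0 < psum R y L <= 1.
  rewrite psum_le1 // andbT; apply: lt_le_trans (psum_mono R y j0L).
  rewrite psumS yj0 ltr_wpDl ?mul1r ?expb_gt0 //.
  by apply: sumr_ge0 => j _; rewrite mulr_ge0 ?ler0n // ltW ?expb_gt0.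
apply: le_trans (max_discrepancy_ge _ (N := N) _); last by rewrite N_gt0 ltnW.
apply: le_trans (discrepancy_ge _ psum01 N_gt0).
have := corner_bound b_gt1 s0 phiK phiVK phi0 cardF xadm xts
  (@shifted_lead Q) (fun n => shifted_lt Qm (n := n)) y01 N_lt top nc_pos gap critical.
apply: le_trans; rewrite ler_wpM2r //.
  by rewrite mulr_ge0 ?subr_ge0 ?ler1n ?(ltnW b_gt1) // ltW ?expb_gt0.
rewrite ler_nat leq_exp2r //; apply: leq_trans (card_corner_digits t s_ge2 d_ge1 q0) _.
apply: subset_leq_card; apply/fintype.subsetP => j; rewrite !inE /y => ->.
exact: eqxx.
Qed.

End Stage.

Theorem theorem6 (R : realType) (b s d t : nat) (F : finFieldType)
    (phi : 'Z_b -> F) (phiV : F -> 'Z_b) (x : nat -> digit_point b s)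
    (hb : prime_power b) (hF : #|F| = b)
    (phiK : cancel phi phiV) (phiVK : cancel phiV phi) (phi0 : phi 0 = 0)
    (hs : (2 <= s)%N) (hd : (1 <= d)%N)
    (xdig : digital phi phiV x)
    (xadm : admissible R d x)
    (xts : ts_sequence R t x) :
  exists (D : nat -> nat -> F) (hinv : nat -> nat),
    [/\ forall k, (1 <= k)%N -> upper_left D (m_seq s d t k) \in unitmx,
        forall k l n, (1 <= k)%N -> (k < l)%N -> (n < b ^ m_seq s d t k)%N ->
          hinv n = hmap_inv phi phiV D (m_seq s d t l) n /\
          hmap_inv phi phiV D (m_seq s d t l) n
            = hmap_inv phi phiV D (m_seq s d t k) n,
        admissible R d (fun n => x (hinv n))
          /\ ts_sequence R t (fun n => x (hinv n))
      & forall k, (1 <= k)%N ->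
          1 + min_max_discrepancy R (m_seq s d t k) x hinv
            >= 2%:R ^- 2 * b%:R ^- d * (4 * (d + t) * s ^ 2)%N%:R ^- s
               * (m_seq s d t k)%:R ^+ s].
Proof.
have b_gt1 : (1 < b)%N.
  case: hb => p [e [pp e0 ->]]; apply: (leq_trans (prime_gt1 pp)).
  by rewrite -{1}(expn1 p) leq_exp2l ?prime_gt1.
have [C xC] := xdig; rewrite {}xC in xadm xts *.
have [p hp] := prescribes_all b_gt1 hs hd phiVK phi0 xadm xts.
have low := @pairing_matrix_low F p; have diag := @pairing_matrix_diag F p.
exists (pairing_matrix F p), (fun n => hmap_inv phi phiV (pairing_matrix F p) n n).
have mE k : m_seq s d t k = rows s d t (4 ^ k).
  by rewrite /m_seq /rows subn1 expnD expnM mulnC [in RHS]mulnC (mulnC 4).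
split.
- by move=> k _; apply: upper_left_unit.
- move=> k l n _ kl nk.
  have nl : (n < b ^ m_seq s d t l)%N.
    apply: leq_trans nk _; rewrite leq_exp2l // leq_mul2l; apply/orP; right.
    by apply: leq_sub2r; rewrite leq_exp2l //; lia.
  have stable := hmap_inv_stable b_gt1 phiK phiVK phi0 low diag.
  by rewrite (stable _ _ nl) (stable _ _ nk).
- by split; [apply: admissible_hinv | apply: ts_sequence_hinv].
move=> k k1; set m := m_seq s d t k; set q := (4 ^ k)%N.
have q0 : (0 < q)%N by rewrite expn_gt0.
have b0 := b_gt0 R b_gt1.
pose bound : R := (q ^ s)%:R * ((b%:R - 1) * b%:R ^- d.+1).
(* Here m / K = (4 q - 1) / 4 <= q and (b - 1) / b >= 1 / 2. *)
apply: (@le_trans _ _ bound).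
  rewrite -[leLHS]mulrA -[_ ^- s]exprVn -exprMn.
  have mK : (4 * (d + t) * s ^ 2)%N%:R^-1 * m%:R <= q%:R :> R.
    have K0 : (0 < 4 * (d + t) * s ^ 2)%N by rewrite !muln_gt0; lia.
    rewrite mulrC ler_pdivrMr ?ltr0n // -natrM ler_nat /m mE /rows -/q; nia.
  apply: (@le_trans _ _ (2%:R ^- 2 * b%:R ^- d * q%:R ^+ s)).
    rewrite ler_wpM2l ?mulr_ge0 ?invr_ge0 ?exprn_ge0 ?ler0n //.
    by apply: lerXn2r; rewrite ?nnegrE ?mulr_ge0 ?invr_ge0 ?ler0n.
  rewrite /bound natrX mulrC ler_wpM2l ?exprn_ge0 ?ler0n // (expbS R b_gt1 d).
  have := expb_gt0 R b_gt1 d.+1; have : 2 <= b%:R :> R by rewrite ler_nat.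
  move: (b%:R ^- d.+1) => e; rewrite expr2; nra.
apply: (@le_trans _ _ (min_max_discrepancy R m (digital_seq phi phiV C)
          (fun n => hmap_inv phi phiV (pairing_matrix F p) n n))); last by rewrite lerDr.
apply: lb_le_inf.
  exists (max_discrepancy (b ^ m) (fun n => point_value R (point_add
     (digital_seq phi phiV C (nat_add b (hmap_inv phi phiV (pairing_matrix F p) n n) 0))
     (fun=> frac_expansion b m 0)))), 0%N, (fun=> frac_expansion b m 0).
  split=> // [|i]; first by rewrite expn_gt0 ltnW.
  by exists 0%N => //=; rewrite expn_gt0 ltnW.
move=> _ [Q [w [Qm _ ->]]]; rewrite /m mE in Qm *.
exact: (stage_bound b_gt1 hs hd phiVK phi0 xadm xts phiK hF w (hp k) q0 Qm).
Qed.
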